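(* Let $X = (X_i)_{1 \le i \le n}$ be a Gaussian vector with covariance kernel $K(i,j) = \mathrm{Cov}[X_i,X_j]$. For all $I_1, I_2 \subseteq \{1,\ldots,n\}$, all increasing events $A_1 \in \sigma(I_1)$ and $A_2 \in \sigma(I_2)$, and all $\varepsilon > 0$, $$\mathbb{P}[X \in A_1 \cap A_2] - \mathbb{P}[X \in A_1]\,\mathbb{P}[X + \varepsilon \in A_2] \le \exp\Big(-\frac{\varepsilon^2}{8\, \|K\|_\infty\, \rho^2(I_1,I_2)}\Big).$$
   Context: For a real number $a$, $X + a$ denotes $X + a\mathbf{1}$, where $\mathbf{1}$ is the vector of ones. $\|K\|_\infty = \max_{i,j} |K(i,j)|$. The maximum correlation coefficient is $$\rho(I_1,I_2) = \sup_{f,g} \frac{|\mathrm{Cov}[f(X|_{I_1}), g(X|_{I_2})]|}{\sqrt{\mathrm{Var}[f(X|_{I_1})]\,\mathrm{Var}[g(X|_{I_2})]}},$$ the supremum being over measurable $f,g$ such that $f(X|_{I_1})$ and $g(X|_{I_2})$ are square-integrable, with the convention $0/0 := 0$. If $\rho(I_1,I_2) = 0$ the right-hand side of the inequality is read as $0$. An event $A$ is a Borel subset of $\mathbb{R}^n$. It is increasing if $x \in A$ implies $x + v \in A$ for every $v \in \mathbb{R}^n$ with $v \ge 0$ coordinatewise. It is supported on $I$, written $A \in \sigma(I)$, if for every $v \in \mathbb{R}^n$ with $v|_I = 0$ one has $x \in A$ if and only if $x + v \in A$. *)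

(* Defs.v *)
From HB Require Import structures.
From mathcomp Require Export all_boot all_order all_algebra.
From mathcomp Require Export all_classical all_reals all_analysis.

Set Implicit Arguments.
Unset Strict Implicit.
Unset Printing Implicit Defensive.

Import Order.TTheory GRing.Theory Num.Theory.
Import numFieldNormedType.Exports.

Local Open Scope classical_set_scope.
Local Open Scope ring_scope.

(* 'rV[R]_n with its Borel sigma-algebra, generated by the open sets. *)
Definition rvec (R : realType) (n : nat) :=
  g_sigma_algebraType (@open 'rV[R]_n).

(* The vector x|_I, with the elements of I listed in increasing order. *)
Definition restr (R : realType) (n : nat) (I : {set 'I_n}) (x : rvec R n)
    : rvec R #|I| :=
  \row_(k < #|I|) (x : 'rV[R]_n) 0 (enum_val k).

Definition increasing_event (R : realType) (n : nat) (A : set (rvec R n)) :=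
  forall x v : 'rV[R]_n, (forall i, 0 <= v 0 i) -> A x -> A (x + v).

Definition supported_on (R : realType) (n : nat) (I : {set 'I_n})
    (A : set (rvec R n)) :=
  forall v : 'rV[R]_n, (forall i, i \in I -> v 0 i = 0) ->
  forall x : 'rV[R]_n, A x <-> A (x + v).

(* The Gaussian law with mean m and standard deviation s. The library's
   normal_prob m 0 is the uniform law on [0, 1], so the degenerate case is
   given separately, as the Dirac mass at m. *)
Definition gaussian_law (R : realType) (m s : R) : set R -> \bar R :=
  if s == 0 then \d_m else normal_prob m s.

(* Every linear combination of the coordinates is Gaussian, possibly
   degenerate; the mean is arbitrary. *)
Definition gaussian_vector (d : measure_display) (T : measurableType d)
    (R : realType) (P : probability T R) (n : nat)
    (X : {RV P >-> rvec R n}) :=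
  forall a : 'rV[R]_n, exists m s : R, 0 <= s /\
    forall B : set R, measurable B ->
      P [set w | B (\sum_i a 0 i * (X w : 'rV[R]_n) 0 i)] = gaussian_law m s B.

Definition covariance_kernel (d : measure_display) (T : measurableType d)
    (R : realType) (P : probability T R) (n : nat)
    (X : {RV P >-> rvec R n}) (K : 'M[R]_n) :=
  forall i j : 'I_n,
    covariance P (fun w => (X w : 'rV[R]_n) 0 i)
                 (fun w => (X w : 'rV[R]_n) 0 j) = (K i j)%:E.

(* Covariances of square-integrable variables are finite, so fine loses
   nothing; the convention 0/0 := 0 is that of the field R. The set is nonempty
   and bounded by 1 (Cauchy-Schwarz), so sup is a genuine supremum. *)
Definition max_correlation (d : measure_display) (T : measurableType d)
    (R : realType) (P : probability T R) (n : nat)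
    (X : {RV P >-> rvec R n}) (I1 I2 : {set 'I_n}) : R :=
  sup [set r | exists (f : rvec R #|I1| -> R) (g : rvec R #|I2| -> R),
    let Y1 := fun w => f (restr I1 (X w)) in
    let Y2 := fun w => g (restr I2 (X w)) in
    [/\ measurable_fun setT f, measurable_fun setT g,
        Y1 \in Lfun P 2%:E, Y2 \in Lfun P 2%:E
      & r = `|fine (covariance P Y1 Y2)|
            / Num.sqrt (fine 'V_P[Y1] * fine 'V_P[Y2])]].

(* Main.v *)
From HB Require Import structures.
Require Import Defs.
From mathcomp Require Import measurable_realfun.
From mathcomp Require Import ring lra.

Set Implicit Arguments.
Unset Strict Implicit.
Unset Printing Implicit Defensive.

Import Order.TTheory GRing.Theory Num.Theory.
Import numFieldNormedType.Exports.

Local Open Scope classical_set_scope.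
Local Open Scope ring_scope.

(** Why the theorem is true.

    Regress every coordinate of [X] on those in [I1]: this gives [X = M + W],
    where [M] is a linear function of the coordinates in [I1] and the residual
    [W] is uncorrelated with them. As [X] is Gaussian, [W] is independent of the
    coordinates in [I1] ([recoupled_law]). With [u x] the probability that
    [x + W] lies in [A2], independence gives
    [P (X in A1 and A2) = E (1_A1 (X) * u M)] and
    [P (X + eps in A2) = E (u (M + eps))].

    The maximum correlation coefficient [rho] enters through the variances of
    [M] only. The regression [M_i] is a function of the coordinates in [I1] and
    its covariance with [X_i] is its own variance; so, for [i] in [I2], this
    variance is at most [rho ^+ 2 * `|K|] ([regression_correlation]).

    For every level [q] the set [B] where [u >= q] is increasing and depends on
    the coordinates in [I2] only. Between a point of [B] and a point which
    stays outside of [B] after adding [eps], some coordinate in [I2] drops by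
    more than [eps]. Seen from a standard Gaussian vector of which [M] is an
    affine image, these are two sets at distance at least
    [eps / (rho * sqrt `|K|)]. Gaussian concentration without any dimensional
    factor bounds the product of their probabilities by
    [exp (- distance ^ 2 / 4)], so one of them has probability at most the bound
    [delta] of the theorem ([increasing_dichotomy]): at each level, [u M] is
    above it with probability at most [delta] or [u (M + eps)] is below it with
    probability at most [delta]. Comparing both variables with a common
    threshold level concludes ([level_decoupling]).

    Two classical facts carry the argument. The Cramer-Wold theorem
    ([cramer_wold]) identifies Gaussian laws; its proof approximates indicators
    of half-spaces by trigonometric polynomials. The concentration of the
    Gaussian measure is Maurey's property tau: if
    [u x * v y <= exp (`|x - y| ^ 2 / 4)] then [E u * E v <= 1]. It tensorizes
    ([standard_gaussianS]), and on the line it is an instance of the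
    Prekopa-Leindler inequality ([property_tau_line]). *)

(** * Bounded random variables *)
Section bounded_measurable.
Context (R : realType) (d : measure_display) (T : measurableType d).
Implicit Types (f g : T -> R).

(** Working with bounded functions keeps every expectation real-valued, so that
    linearity, dominated convergence and Fubini hold without side conditions. *)
Definition bounded_mfun (f : T -> R) :=
  measurable_fun setT f /\ exists C, forall x, `|f x| <= C.

Lemma bounded_mfun_cst c : bounded_mfun (fun=> c).
Proof. by split; [exact: measurable_cst|exists `|c|]. Qed.

Lemma bounded_mfunD f g : bounded_mfun f -> bounded_mfun g ->
  bounded_mfun (fun x => f x + g x).
Proof.
move=> [mf [C fC]] [mg [D gD]]; split; first exact: measurable_funD.
by exists (C + D) => x; rewrite (le_trans (ler_normD _ _))// lerD.
Qed.

Lemma bounded_mfunM f g : bounded_mfun f -> bounded_mfun g ->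
  bounded_mfun (fun x => f x * g x).
Proof.
move=> [mf [C fC]] [mg [D gD]]; split; first exact: measurable_funM.
by exists (C * D) => x; rewrite normrM ler_pM.
Qed.

Lemma bounded_mfun_indic (A : set T) : measurable A -> bounded_mfun (\1_A : T -> R).
Proof.
move=> mA; split; first exact: measurable_indic.
by exists 1 => x; rewrite indicE; case: (_ \in _); rewrite ?normr1 ?normr0.
Qed.

Lemma bounded_mfun_cos f : measurable_fun setT f -> bounded_mfun (fun x => cos (f x)).
Proof.
move=> mf; split.
  apply: (measurableT_comp _ mf); apply: continuous_measurable_fun.
  exact: continuous_cos.
by exists 1 => x; rewrite ler_norml cos_geN1 cos_le1.
Qed.

Variable P : probability T R.

Lemma bounded_mfun_integrable f : bounded_mfun f -> P.-integrable setT (EFin \o f).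
Proof.
move=> [mf [C fC]]; apply: (@le_integrable _ _ _ P setT _ _ (EFin \o cst C)) => //=.
- exact/measurable_EFinP.
- by move=> x _; rewrite lee_fin (le_trans (fC x))// ler_norm.
- exact: finite_measure_integrable_cst.
Qed.

Lemma Rintegral_boundedD f g : bounded_mfun f -> bounded_mfun g ->
  \int[P]_x (f x + g x) = \int[P]_x f x + \int[P]_x g x.
Proof. by move=> bf bg; rewrite RintegralD//; exact: bounded_mfun_integrable. Qed.

Lemma Rintegral_boundedB f g : bounded_mfun f -> bounded_mfun g ->
  \int[P]_x (f x - g x) = \int[P]_x f x - \int[P]_x g x.
Proof. by move=> bf bg; rewrite RintegralB//; exact: bounded_mfun_integrable. Qed.

Lemma le_Rintegral_bounded (f g : T -> R) : bounded_mfun f -> bounded_mfun g ->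
  (forall w, f w <= g w) ->
  \int[P]_w f w <= \int[P]_w g w.
Proof.
by move=> bf bg fg; apply: le_Rintegral => //; exact: bounded_mfun_integrable.
Qed.

Lemma Rintegral_boundedZ c f : bounded_mfun f ->
  \int[P]_x (c * f x) = c * \int[P]_x f x.
Proof. by move=> bf; rewrite RintegralZl//; exact: bounded_mfun_integrable. Qed.

Lemma Rintegral_prob_cst c : \int[P]_x c = c.
Proof. by rewrite Rintegral_cst// [X in fine X]probability_setT mulr1. Qed.

Lemma Rintegral_boundedE f : bounded_mfun f ->
  (\int[P]_x f x)%:E = (\int[P]_x (f x)%:E)%E.
Proof.
move=> bf; rewrite /Rintegral fineK//.
exact/integrable_fin_num/bounded_mfun_integrable.
Qed.

Lemma Rintegral_indic (A : set T) : measurable A -> (\int[P]_x \1_A x)%:E = P A.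
Proof.
move=> mA; rewrite Rintegral_boundedE; last exact: bounded_mfun_indic.
by rewrite integral_indic// setIT.
Qed.

Lemma bounded_convergence (f_ : nat -> T -> R) f C :
  (forall n, measurable_fun setT (f_ n)) ->
  (forall n x, `|f_ n x| <= C) -> (forall x, f_ n x @[n --> \oo] --> f x) ->
  bounded_mfun f /\ (\int[P]_x f_ n x @[n --> \oo] --> \int[P]_x f x).
Proof.
move=> mf_ fC cf.
have bf : bounded_mfun f.
  split; first by apply: (@measurable_fun_cvg _ _ _ setT f_) => // x _; exact: cf.
  exists C => x.
  have cn : `|f_ n x| @[n --> \oo] --> `|f x| by apply: cvg_norm; exact: cf.
  by apply: (cvgr_to_le cn); apply: nearW => n; exact: fC.
split=> //; apply: fine_cvg; rewrite -/(Rintegral _ _ _) Rintegral_boundedE//.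
apply: (@dominated_cvg _ _ _ P setT _ _ _ (EFin \o cst C)) => //=.
- by move=> n; exact/measurable_EFinP.
- by move=> x _; apply/fine_cvgP; split; [exact: nearW|exact: cf].
- exact: finite_measure_integrable_cst.
- by move=> n x _; rewrite lee_fin.
Qed.

End bounded_measurable.
Arguments bounded_mfun_cst {R d T} c.

Section bounded_fubini.
Context (R : realType) (d1 d2 : measure_display).
Context (T1 : measurableType d1) (T2 : measurableType d2).
Context (P1 : probability T1 R) (P2 : probability T2 R).

Lemma bounded_mfun_section (u : T1 * T2 -> R) x : bounded_mfun u ->
  bounded_mfun (fun y => u (x, y)).
Proof.
move=> [mu [C uC]]; split.
  by apply: (measurableT_comp mu); exact: measurable_pair1.
by exists C => y; exact: uC.
Qed.

Lemma fubini_bounded (u : T1 * T2 -> R) : bounded_mfun u ->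
  bounded_mfun (fun x => \int[P2]_y u (x, y)) /\
  \int[(P1 \x P2)%E]_z u z = \int[P1]_x \int[P2]_y u (x, y).
Proof.
move=> bu.
have iu : (P1 \x P2)%E.-integrable setT (EFin \o u) by exact: bounded_mfun_integrable.
have mF : measurable_fun setT (fun x => \int[P2]_y u (x, y)).
  apply: (measurableT_comp (f := fine)) => //; exact: (measurable_fubini_F iu).
have bF : bounded_mfun (fun x => \int[P2]_y u (x, y)).
  split=> //; have [_ [C uC]] := bu; exists C => x.
  have bx := bounded_mfun_section x bu.
  rewrite (le_trans (le_normr_Rintegral _ _))//; first exact: bounded_mfun_integrable.
  rewrite -(Rintegral_prob_cst P2 C); apply: le_Rintegral => //.
  - by apply: integrable_norm; exact: bounded_mfun_integrable.
  - by apply: bounded_mfun_integrable; exact: bounded_mfun_cst.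
split=> //; apply: EFin_inj; rewrite !Rintegral_boundedE// -(integral12_prod_meas1 iu).
by apply: eq_integral => x _; rewrite Rintegral_boundedE//; exact: bounded_mfun_section.
Qed.

End bounded_fubini.

(** * The Borel sets of a space of row vectors *)

Section borel_half_spaces.
Context (R : realType) (n : nat).

(** These sets generate the Borel sets, so a map into row vectors is Borel as
    soon as its coordinates are. *)
Definition half_spaces : set (set 'rV[R]_n) :=
  [set A | exists (i : 'I_n) (b : R), A = [set x : 'rV[R]_n | b < x 0 i]].

(** An open set is the union of the half-open rational boxes it contains, and
    there are countably many of them. *)
Lemma open_half_spaces (U : set 'rV[R]_n) : open U -> <<s half_spaces >> U.
Proof.
move=> oU.
pose box (q : 'rV[rat]_n * 'rV[rat]_n) : set 'rV[R]_n :=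
  [set x | forall i, ratr (q.1 0 i) < x 0 i <= ratr (q.2 0 i)].
pose F q := if `[< box q `<=` U >] then box q else set0.
have -> : U = \bigcup_q F q.
  apply/seteqP; split=> [x Ux|x [q _]]; last first.
    by rewrite /F; case: ifPn => // /asboolP; exact.
  have /nbhs_ballP[e /= e0 xeU] : nbhs x U by rewrite nbhsE/=; exists U.
  have lo i : exists q : rat, x 0 i - e < ratr q < x 0 i.
    by have [q] := @rat_in_itvoo R (x 0 i - e) (x 0 i) ltac:(lra);
      rewrite in_itv/= => qi; exists q.
  have hi i : exists q : rat, x 0 i < ratr q < x 0 i + e.
    by have [q] := @rat_in_itvoo R (x 0 i) (x 0 i + e) ltac:(lra);
      rewrite in_itv/= => qi; exists q.
  pose q1 := \row_i projT1 (cid (lo i)); pose q2 := \row_i projT1 (cid (hi i)).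
  exists (q1, q2) => //; rewrite /F asboolT.
    move=> i /=; rewrite !mxE; case: cid => /= a /andP[a1 a2].
    by case: cid => /= b /andP[b1 b2]; rewrite a2 ltW.
  move=> y /= qy; apply: xeU; split=> // i j; rewrite /ball/= !ord1.
  have := qy j; rewrite !mxE; case: cid => /= a /andP[a1 a2].
  case: cid => /= b /andP[b1 b2] /andP[ay yb].
  by rewrite ltr_norml; apply/andP; split; lra.
pose M := g_sigma_algebraType half_spaces.
have mH (i : 'I_n) (b : R) : measurable ([set x : 'rV[R]_n | b < x 0 i] : set M).
  by apply: sub_sigma_algebra; exists i, b.
suff mF q : measurable (F q : set M).
  by have := @countable_bigcupT_measurable _ M _ F (countableP _) mF.
rewrite /F; case: ifP => // _.
have -> : box q = \bigcap_(i in [set: 'I_n])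
    ([set x : 'rV[R]_n | ratr (q.1 0 i) < x 0 i] `\`
     [set x : 'rV[R]_n | ratr (q.2 0 i) < x 0 i]).
  apply/seteqP; split=> x /=.
    by move=> qx i _; have /andP[? ?] := qx i; split=> //=; apply/negP; rewrite -leNgt.
  by move=> qx i; have [/= -> /negP] := qx i I; rewrite -leNgt.
apply: (@fin_bigcap_measurable _ M); first exact: finite_finset.
by move=> i _; apply: measurableD; exact: mH.
Qed.

Lemma rvec_half_spaces : @measurable _ (rvec R n) `<=` <<s half_spaces >>.
Proof.
apply: smallest_sub; first exact: smallest_sigma_algebra.
exact: open_half_spaces.
Qed.

Lemma measurable_rvec d (T : measurableType d) (V : T -> rvec R n) :
  (forall i, measurable_fun setT (fun w => (V w : 'rV[R]_n) 0 i)) ->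
  measurable_fun setT V.
Proof.
move=> mV; apply: (@measurability _ _ _ _ setT V (@open 'rV[R]_n)) => //.
move=> _ [A oA <-]; rewrite setTI.
pose Q := [set B : set 'rV[R]_n | measurable (V @^-1` B)].
suff /(_ A) : <<s half_spaces >> `<=` Q by apply; exact: open_half_spaces.
apply: smallest_sub.
  split => //=.
  - by rewrite /Q /= preimage_set0.
  - by move=> B mB; rewrite /Q /= setTD -preimage_setC; exact: measurableC.
  - by move=> F mF; rewrite /Q /= preimage_bigcup; exact: bigcupT_measurable.
move=> _ [i [b ->]] /=.
have := mV i measurableT `]b, +oo[%classic (measurable_itv _); rewrite setTI.
by congr (measurable _); apply/seteqP; split=> w /=; rewrite in_itv/= andbT.
Qed.

Lemma measurable_coord (i : 'I_n) :
  measurable_fun setT (fun x : rvec R n => (x : 'rV[R]_n) 0 i).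
Proof.
apply: (@measurability _ _ _ (measurableTypeR R) setT _ (@RGenOInfty.G R)).
  exact: RGenOInfty.measurableE.
move=> _ [_ [b ->] <-]; rewrite setTI; apply: sub_sigma_algebra => /=.
apply: open_comp; last exact: interval_open.
by move=> x _; exact: coord_continuous.
Qed.

End borel_half_spaces.

(** * The Cramer-Wold theorem *)
Section sign_polynomial.
Context (R : realType).
Implicit Types s : R.

(** The fixed points of this odd cubic are -1, 0 and 1, and 0 is repelling:
    iterating it turns the sine into a square wave while staying among the
    polynomials in the sine. *)
Definition sign_step s : R := (3 * s - s ^+ 3) / 2.

Lemma sign_step_bound s : `|s| <= 1 -> `|sign_step s| <= 1.
Proof.
rewrite !ler_norml /sign_step => /andP[s1 s2].
have h1 : 0 <= (1 - s) ^+ 2 * (2 + s) by rewrite mulr_ge0 ?sqr_ge0//; lra.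
have h2 : 0 <= (1 + s) ^+ 2 * (2 - s) by rewrite mulr_ge0 ?sqr_ge0//; lra.
by apply/andP; split; nra.
Qed.

Lemma iter_sign_step_bound s N : `|s| <= 1 -> `|iter N sign_step s| <= 1.
Proof. by move=> s1; elim: N => //= N; exact: sign_step_bound. Qed.

Lemma iter_sign_stepN s N : iter N sign_step (- s) = - iter N sign_step s.
Proof. by elim: N => //= N ->; rewrite /sign_step; field. Qed.

(** The distance to the attracting fixed point 1 is multiplied at each step by
    [(1 - t) * (2 + t) / 2], which is at most [1 - s / 2] for [t >= s]. *)
Let iter_sign_step_gt0 s N : 0 < s <= 1 ->
  s <= iter N sign_step s <= 1 /\ 1 - iter N sign_step s <= (1 - s / 2) ^+ N.
Proof.
move=> /andP[s0 s1]; elim: N => [|N [/andP[h1 h2] h3]].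
  by rewrite /= expr0 lexx s1; split => //; lra.
rewrite iterS; set t := iter N sign_step s in h1 h2 h3 *.
have tE : 1 - sign_step t = (1 - t) * ((1 - t) * (2 + t) / 2).
  by rewrite /sign_step; field.
have t0 : 0 <= (1 - t) * (2 + t) / 2 by rewrite !mulr_ge0//; lra.
split.
  apply/andP; split.
    rewrite (le_trans h1)// /sign_step.
    have : 0 <= t * (1 - t) * (1 + t) by rewrite !mulr_ge0//; lra.
    by nra.
  by rewrite -subr_ge0 tE mulr_ge0// subr_ge0.
rewrite tE exprSr; apply: ler_pM => //; first by rewrite subr_ge0.
by have := sqr_ge0 t; nra.
Qed.

Lemma cvg_iter_sign_step s : `|s| <= 1 ->
  iter N sign_step s @[N --> \oo] --> Num.sg s.
Proof.
have pos u : 0 < u -> u <= 1 -> iter N sign_step u @[N --> \oo] --> (1 : R).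
  move=> u0 u1; apply/subr_cvg0.
  have -> : (fun N => iter N sign_step u - 1) = (fun N => - (1 - iter N sign_step u)).
    by apply/funext => N; rewrite opprB.
  rewrite -oppr0; apply: cvgN.
  apply: (@squeeze_cvgr _ _ _ _ (fun=> 0) (fun N => (1 - u / 2) ^+ N)).
  - apply: nearW => N; have [|/andP[_ ?] ->] := @iter_sign_step_gt0 u N.
      by rewrite u0.
    by rewrite subr_ge0 andbT.
  - exact: cvg_cst.
  - by apply: cvg_expr; rewrite ger0_norm; lra.
move=> s1; have [s0|s0|->] := ltgtP s 0.
- rewrite ltr0_sg//.
  have -> : (fun N => iter N sign_step s) = (fun N => - iter N sign_step (- s)).
    by apply/funext => N; rewrite iter_sign_stepN opprK.
  apply: cvgN; apply: pos; first by rewrite oppr_gt0.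
  by move: s1; rewrite ler_norml lerNl => /andP[].
- by rewrite gtr0_sg//; apply: pos => //; rewrite (le_trans (ler_norm _)).
- rewrite sgr0.
  suff -> : (fun N => iter N sign_step 0) = (fun=> 0 : R) by exact: cvg_cst.
  apply/funext => N; elim: N => //= N ->.
  by rewrite /sign_step mulr0 expr0n subr0 mul0r.
Qed.

End sign_polynomial.

Section cramer_wold.
Context (R : realType) (d d' : measure_display).
Context (T : measurableType d) (T' : measurableType d').
Context (P : probability T R) (P' : probability T' R) (n : nat).
Context (V : T -> 'rV[R]_n) (V' : T' -> 'rV[R]_n).
Hypothesis mV : forall i, measurable_fun setT (fun w => V w 0 i).
Hypothesis mV' : forall i, measurable_fun setT (fun w => V' w 0 i).

Definition dotp (a x : 'rV[R]_n) : R := \sum_i a 0 i * x 0 i.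

Lemma dotpD a b x : dotp (a + b) x = dotp a x + dotp b x.
Proof. by rewrite -big_split; apply: eq_bigr => i _; rewrite mxE mulrDl. Qed.

Lemma dotpN a x : dotp (- a) x = - dotp a x.
Proof. by rewrite /dotp -sumrN; apply: eq_bigr => i _; rewrite mxE mulNr. Qed.

Lemma dotp0 x : dotp 0 x = 0.
Proof. by apply: big1 => i _; rewrite mxE mul0r. Qed.

Lemma dotp_delta c i x : dotp (c *: delta_mx 0 i) x = c * x 0 i.
Proof.
rewrite /dotp (bigD1 i)//= !mxE !eqxx mulr1 big1 ?addr0// => j ji.
by rewrite !mxE eqxx (negbTE ji) mulr0 mul0r.
Qed.

Lemma measurable_dotp d0 (T0 : measurableType d0) (U : T0 -> 'rV[R]_n) a :
  (forall i, measurable_fun setT (fun w => U w 0 i)) ->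
  measurable_fun setT (fun w => dotp a (U w)).
Proof.
by move=> mU; apply: measurable_sum => i; apply: measurable_funM => //.
Qed.

(** Test functions which the two laws integrate equally against every
    character. *)
Definition balanced (h : 'rV[R]_n -> R) :=
  [/\ bounded_mfun (h \o V), bounded_mfun (h \o V') &
    forall a b, \int[P]_w (h (V w) * cos (dotp a (V w) + b)) =
                \int[P']_w (h (V' w) * cos (dotp a (V' w) + b))].

(** Multipliers of the balanced functions are closed under products by
    definition; they are also closed under linear combinations and bounded
    pointwise limits, so the sets with multiplier indicators form a
    sigma-algebra. *)
Definition multiplier (g : 'rV[R]_n -> R) :=
  [/\ bounded_mfun (g \o V), bounded_mfun (g \o V') &
    forall h, balanced h -> balanced (fun x => g x * h x)].

Let bcos a b : bounded_mfun (fun w => cos (dotp a (V w) + b)).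
Proof.
by apply: bounded_mfun_cos; apply: measurable_funD => //; exact: measurable_dotp.
Qed.

Let bcos' a b : bounded_mfun (fun w => cos (dotp a (V' w) + b)).
Proof.
by apply: bounded_mfun_cos; apply: measurable_funD => //; exact: measurable_dotp.
Qed.

Lemma multiplier_cst c : multiplier (fun=> c).
Proof.
split; [exact: bounded_mfun_cst|exact: bounded_mfun_cst|] => h [bh bh' e].
split=> [||a b].
- exact: (bounded_mfunM (bounded_mfun_cst c) bh).
- exact: (bounded_mfunM (bounded_mfun_cst c) bh').
under eq_Rintegral do rewrite -mulrA.
under [RHS]eq_Rintegral do rewrite -mulrA.
by rewrite !Rintegral_boundedZ ?e//; exact: bounded_mfunM.
Qed.

Lemma multiplierM f g : multiplier f -> multiplier g ->
  multiplier (fun x => f x * g x).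
Proof.
move=> [bf bf' mf] [bg bg' mg]; split; [exact: bounded_mfunM|exact: bounded_mfunM|].
move=> h /mg /mf; congr balanced; apply/funext => x; exact: mulrA.
Qed.

Lemma multiplierD f g : multiplier f -> multiplier g ->
  multiplier (fun x => f x + g x).
Proof.
move=> [bf bf' mf] [bg bg' mg]; split; [exact: bounded_mfunD|exact: bounded_mfunD|].
move=> h bh; have [bf1 bf2 e1] := mf _ bh; have [bg1 bg2 e2] := mg _ bh.
have [h1 h2 _] := bh.
split=> [||a b].
- exact: (bounded_mfunM (bounded_mfunD bf bg) h1).
- exact: (bounded_mfunM (bounded_mfunD bf' bg') h2).
under eq_Rintegral do rewrite 2!mulrDl.
under [RHS]eq_Rintegral do rewrite 2!mulrDl.
by rewrite !Rintegral_boundedD ?e1 ?e2//; exact: bounded_mfunM.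
Qed.

Lemma multiplier_lim (g_ : nat -> 'rV[R]_n -> R) (g : 'rV[R]_n -> R) (C : R) :
  (forall k, multiplier (g_ k)) -> (forall k x, `|g_ k x| <= C) ->
  (forall x, g_ k x @[k --> \oo] --> g x) -> multiplier g.
Proof.
move=> mg gC cg.
have lim d0 (T0 : measurableType d0) (P0 : probability T0 R)
    (U : T0 -> 'rV[R]_n) k :
    (forall i, bounded_mfun (g_ i \o U)) -> bounded_mfun (k \o U) ->
    (bounded_mfun (g \o U)) /\
    (\int[P0]_w (g_ i (U w) * k (U w)) @[i --> \oo] -->
     \int[P0]_w (g (U w) * k (U w))).
  move=> bg bk; have [mk [D kD]] := bk; split.
    have [] // := @bounded_convergence _ _ _ P0 (fun i => g_ i \o U) (g \o U) C.
    - by move=> i; have [] := bg i.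
    - by move=> i w; exact: gC.
    - by move=> w; exact: cg.
  have [] // := @bounded_convergence _ _ _ P0 (fun i w => g_ i (U w) * k (U w))
    (fun w => g (U w) * k (U w)) (C * D).
  - by move=> i; have [? _] := bounded_mfunM (bg i) bk.
  - by move=> i w; rewrite normrM ler_pM//; exact: kD.
  - by move=> w; apply: cvgM; [exact: cg|exact: cvg_cst].
have bg : bounded_mfun (g \o V).
  have [|//] := lim _ _ P V (fun=> 0) _ (bounded_mfun_cst 0).
  by move=> i; have [] := mg i.
have bg' : bounded_mfun (g \o V').
  have [|//] := lim _ _ P' V' (fun=> 0) _ (bounded_mfun_cst 0).
  by move=> i; have [] := mg i.
split=> // h bh; have [h1 h2 _] := bh.
split=> [||a b]; [exact: (bounded_mfunM bg h1)|exact: (bounded_mfunM bg' h2)|].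
pose k x := h x * cos (dotp a x + b).
have [|_ l1] := lim _ _ P V k _ (bounded_mfunM h1 (bcos a b)).
  by move=> i; have [] := mg i.
have [|_ l2] := lim _ _ P' V' k _ (bounded_mfunM h2 (bcos' a b)).
  by move=> i; have [] := mg i.
under eq_Rintegral do rewrite -mulrA.
under [RHS]eq_Rintegral do rewrite -mulrA.
have e12 : (fun i => \int[P]_w (g_ i (V w) * k (V w))) =
           (fun i => \int[P']_w (g_ i (V' w) * k (V' w))).
  apply/funext => i; have [_ _ /(_ h bh) [_ _ /(_ a b) e]] := mg i.
  under eq_Rintegral do rewrite mulrA.
  by rewrite e; apply: eq_Rintegral => w _; rewrite mulrA.
by rewrite e12 in l1; exact: (cvg_unique (@Rhausdorff R) l1 l2).
Qed.

(** A product of two cosines is half the sum of the cosines of the sum and of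
    the difference of the phases, so characters act on balanced functions. *)
Lemma multiplier_cos c e : multiplier (fun x => cos (dotp c x + e)).
Proof.
split=> [||h [h1 h2 eh]]; [exact: bcos|exact: bcos'|].
split=> [||a b].
- exact: (bounded_mfunM (bcos c e) h1).
- exact: (bounded_mfunM (bcos' c e) h2).
have prod x : cos (dotp c x + e) * h x * cos (dotp a x + b) =
    2^-1 * (h x * cos (dotp (c + a) x + (e + b)) +
            h x * cos (dotp (c - a) x + (e - b))).
  rewrite dotpD dotpD dotpN.
  rewrite (_ : dotp c x + dotp a x + _ = (dotp c x + e) + (dotp a x + b)); last by ring.
  rewrite (_ : dotp c x - dotp a x + _ = (dotp c x + e) - (dotp a x + b)); last by ring.
  by move: (dotp c x + e) (dotp a x + b) => u v; rewrite cosD cosB; field.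
under eq_Rintegral do rewrite prod.
under [RHS]eq_Rintegral do rewrite prod.
rewrite !Rintegral_boundedZ ?Rintegral_boundedD ?eh//; do ?exact: bounded_mfunM.
  by apply: bounded_mfunD; exact: bounded_mfunM.
by apply: bounded_mfunD; exact: bounded_mfunM.
Qed.

Lemma multiplierB f g : multiplier f -> multiplier g ->
  multiplier (fun x => f x - g x).
Proof.
move=> mf mg; have := multiplierD mf (multiplierM (multiplier_cst (-1)) mg).
by congr multiplier; apply/funext => x; rewrite mulN1r.
Qed.

Lemma multiplier_sin_coord c e i : multiplier (fun x => sin (c * x 0 i + e)).
Proof.
have := multiplierM (multiplier_cst (-1))
  (multiplier_cos (c *: delta_mx 0 i) (e + pi / 2)).
congr multiplier; apply/funext => x.
by rewrite dotp_delta addrA cosDpihalf mulN1r opprK.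
Qed.

Lemma multiplier_sg_sin_coord c e i :
  multiplier (fun x => Num.sg (sin (c * x 0 i + e))).
Proof.
have sin1 (y : R) : `|sin y| <= 1 by rewrite ler_norml sin_geN1 sin_le1.
apply: (@multiplier_lim
  (fun N x => iter N (@sign_step R) (sin (c * x 0 i + e))) _ 1).
- elim=> [|N IH] /=; first exact: multiplier_sin_coord.
  have := multiplierM (multiplier_cst 2^-1)
    (multiplierB (multiplierM (multiplier_cst 3) IH)
                 (multiplierM IH (multiplierM IH IH))).
  by congr multiplier; apply/funext => x; rewrite /sign_step !exprS expr0 mulr1 mulrC.
- by move=> N x; exact: iter_sign_step_bound.
- by move=> x; exact: cvg_iter_sign_step.
Qed.

(** For a fixed argument [y], the sign of [sin (y / k)] is that of [y] for all
    large [k]: the period of the square wave is sent to infinity. *)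
Lemma multiplier_sg_coord b i : multiplier (fun x => Num.sg (x 0 i - b)).
Proof.
apply: (@multiplier_lim
  (fun k x => Num.sg (sin (k.+1%:R^-1 * x 0 i + - (k.+1%:R^-1 * b)))) _ 1).
- by move=> k; exact: multiplier_sg_sin_coord.
- by move=> k x; rewrite normr_sg; case: (_ != _) => //=; rewrite ler01.
move=> x; set y := x 0 i - b.
have small (z : R) : 0 < z -> \forall k \near \oo, 0 < sin (k.+1%:R^-1 * z).
  move=> z0; near=> k; apply: sin_gt0_pi.
  apply/andP; split; first by rewrite mulr_gt0 ?invr_gt0.
  rewrite mulrC ltr_pdivrMr// -ltr_pdivrMl ?pi_gt0//.
  near: k; exists (Num.truncn (pi^-1 * z)).+1 => // k /= kz.
  by rewrite (lt_trans (truncnS_gt _))// ltr_nat ltnS.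
have yE k : sin (k.+1%:R^-1 * x 0 i + - (k.+1%:R^-1 * b)) = sin (k.+1%:R^-1 * y).
  by rewrite /y mulrBr.
under eq_fun do rewrite yE.
have [y0|y0|->] := ltgtP y 0.
- rewrite ltr0_sg//; apply: cvg_near_cst; near=> k.
  apply: ltr0_sg; rewrite -oppr_gt0 -sinN -mulrN.
  by near: k; apply: small; rewrite oppr_gt0.
- by rewrite gtr0_sg//; apply: cvg_near_cst; near=> k; apply: gtr0_sg;
    near: k; exact: small.
- by under eq_fun do rewrite mulr0 sin0; rewrite sgr0; exact: cvg_cst.
Unshelve. all: by end_near. Qed.

(** With [h] the sign, [(h * h + h) / 2] is the indicator of [h = 1]; this
    settles the value at the boundary. *)
Lemma multiplier_half_space b i : multiplier (\1_[set x | b < x 0 i]).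
Proof.
have mh := multiplier_sg_coord b i.
have := multiplierM (multiplier_cst 2^-1)
  (multiplierD (multiplierM mh mh) mh).
congr multiplier; apply/funext => x; rewrite indicE.
have [h|h|h] := ltgtP (x 0 i) b.
- by rewrite ltr0_sg ?subr_lt0// memNset//=; [field|apply/negP; rewrite -leNgt ltW].
- by rewrite gtr0_sg ?subr_gt0// mem_set//=; field.
- by rewrite h subrr sgr0 memNset//=; [field|rewrite h ltxx].
Qed.

Lemma multiplier_measurable (A : set (rvec R n)) : measurable A ->
  multiplier (\1_A).
Proof.
move=> /rvec_half_spaces; pose Q := [set A : set 'rV[R]_n | multiplier (\1_A)].
suff : <<s @half_spaces R n >> `<=` Q by apply.
apply: smallest_sub; last by move=> _ [i [b ->]]; exact: multiplier_half_space.
split => /=.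
- by rewrite /Q /= indic0; exact: multiplier_cst.
- move=> B mB; have := multiplierB (multiplier_cst 1) mB.
  congr multiplier; apply/funext => x; rewrite !indicE in_setD in_setT/=.
  by case: (x \in B); rewrite ?subr0 ?subrr.
move=> F mF; rewrite /Q/=.
apply: (@multiplier_lim (fun N x => 1 - \prod_(k < N) (1 - \1_(F k) x)) _ 1).
- move=> N; apply: multiplierB; first exact: multiplier_cst.
  elim: N => [|N IH].
    by have := multiplier_cst 1; congr multiplier; apply/funext => x; rewrite big_ord0.
  have := multiplierM IH (multiplierB (multiplier_cst 1) (mF N)).
  by congr multiplier; apply/funext => x; rewrite big_ord_recr.
- move=> N x.
  have h k : 0 <= (1 - \1_(F k) x : R) <= 1.
    by rewrite !indicE; case: (_ \in _); rewrite ?subr0 ?subrr ?lexx ?ler01.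
  have p0 : 0 <= \prod_(k < N) (1 - \1_(F k) x : R).
    by apply: prodr_ge0 => k _; have /andP[] := h k.
  have p1 : \prod_(k < N) (1 - \1_(F k) x : R) <= 1.
    by apply: prodr_ile1 => k _; exact: h.
  by rewrite ler_norml; apply/andP; split; lra.
move=> x; rewrite indicE.
have [xF|xF] := boolP (x \in \bigcup_k F k).
  move: xF; rewrite inE => -[k0 _ xk0]; apply: cvg_near_cst; exists k0.+1 => // N /= kN.
  rewrite (bigD1 (Ordinal kN))//= indicE mem_set// subrr mul0r subr0//.
apply: cvg_near_cst; apply: nearW => N; rewrite big1 ?subrr// => k _.
rewrite indicE memNset ?subr0// => xFk; move/negP: xF; apply.
by rewrite inE; exists k.
Qed.

(** Two random vectors whose linear functionals have the same characteristic
    functions have the same law: the indicator of every Borel set is a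
    multiplier, and the constant 1 is balanced. *)
Theorem cramer_wold :
  (forall a b, \int[P]_w cos (dotp a (V w) + b) =
               \int[P']_w cos (dotp a (V' w) + b)) ->
  forall A : set (rvec R n), measurable A -> P (V @^-1` A) = P' (V' @^-1` A).
Proof.
move=> VV' A mA.
have mVA : measurable (V @^-1` A).
  by rewrite -[_ @^-1` _]setTI; exact: (@measurable_rvec _ _ _ _ V).
have mVA' : measurable (V' @^-1` A).
  by rewrite -[_ @^-1` _]setTI; exact: (@measurable_rvec _ _ _ _ V').
have [_ _ /(_ (fun=> 1))] := multiplier_measurable mA.
case.
  split=> [||a b]; [exact: bounded_mfun_cst|exact: bounded_mfun_cst|].
  by under eq_Rintegral do rewrite mul1r; under [RHS]eq_Rintegral do rewrite mul1r.
move=> _ _ /(_ 0 0) e.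
rewrite -(Rintegral_indic P mVA) -(Rintegral_indic P' mVA'); congr EFin.
have cos1 d0 (T0 : measurableType d0) (Q : probability T0 R) (U : T0 -> 'rV[R]_n) :
    \int[Q]_w (\1_A (U w) * 1 * cos (dotp 0 (U w) + 0)) =
    \int[Q]_w (\1_(U @^-1` A) w).
  by apply: eq_Rintegral => w _; rewrite dotp0 addr0 cos0 !mulr1.
by rewrite !cos1 in e.
Qed.

End cramer_wold.

(** * The one-dimensional normal law *)
Section density.
Import HBNNSimple.
Context (R : realType) (d : measure_display) (T : measurableType d).
Context (mu nu : {measure set T -> \bar R}) (g : T -> R).
Hypothesis mg : measurable_fun setT g.
Hypothesis g0 : forall x, 0 <= g x.
Hypothesis nuE : forall A, measurable A -> nu A = (\int[mu]_(x in A) (g x)%:E)%E.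
Local Open Scope ereal_scope.

Lemma ge0_integral_density (f : T -> \bar R) :
  measurable_fun setT f -> (forall x, 0 <= f x) ->
  \int[nu]_x f x = \int[mu]_x (f x * (g x)%:E).
Proof.
move=> mf f0; pose h := nnsfun_approx measurableT mf.
have ch (x : T) : (h n x)%:E @[n --> \oo] --> f x by exact: cvg_nnsfun_approx.
have nh (x : T) : {homo (fun n => h n x) : n m / (n <= m)%N >-> (n <= m)%R}.
  by move=> a b ab; exact/lefP/nd_nnsfun_approx.
have lhs : \int[nu]_x (EFin \o h n) x @[n --> \oo] --> \int[nu]_x f x.
  rewrite [X in _ --> X](_ : _ = \int[nu]_x limn (fun n => (h n x)%:E)).
    apply: cvg_monotone_convergence => //.
    - by move=> n; exact/measurable_EFinP.
    - by move=> n x _; rewrite lee_fin.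
    - by move=> x _ a b ab; rewrite lee_fin; exact: nh.
  by apply: eq_integral => x _; apply/esym/cvg_lim.
have rhs : \int[mu]_x ((h n x)%:E * (g x)%:E) @[n --> \oo] -->
    \int[mu]_x (f x * (g x)%:E).
  rewrite [X in _ --> X](_ : _ = \int[mu]_x limn (fun n => (h n x)%:E * (g x)%:E)).
    apply: cvg_monotone_convergence => //.
    - by move=> n; apply: emeasurable_funM; exact/measurable_EFinP.
    - by move=> n x _; rewrite mule_ge0 ?lee_fin.
    - by move=> x _ a b ab; rewrite lee_wpmul2r ?lee_fin//; exact: nh.
  apply: eq_integral => x _; apply/esym/cvg_lim => //.
  by apply: cvgeZr => //; exact: ch.
have E n : \int[nu]_x (EFin \o h n) x = \int[mu]_x ((h n x)%:E * (g x)%:E).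
  transitivity (\int[nu]_x
     (\sum_(y \in range (h n)) (y * \1_(h n @^-1` [set y]) x)%:E)).
    by apply: eq_integral => t _; rewrite /= fimfunE -fsumEFin.
  rewrite ge0_integral_fsum//; last 2 first.
    - by move=> y; apply/measurable_EFinP; exact: measurable_funM.
    - by move=> m y _; exact: nnfun_muleindic_ge0.
  transitivity (\int[mu]_x (\sum_(y \in range (h n))
      (y * \1_(h n @^-1` [set y]) x)%:E * (g x)%:E)); last first.
    apply: eq_integral => x _.
    rewrite -ge0_mule_fsuml => [|y]; last exact: nnfun_muleindic_ge0.
    by rewrite fsumEFin // -(fimfunE _ x).
  rewrite ge0_integral_fsum//; last 2 first.
    - move=> y; apply: emeasurable_funM; apply/measurable_EFinP => //.
      exact: measurable_funM.
    - move=> m y _; apply: mule_ge0; last by rewrite lee_fin.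
      exact: nnfun_muleindic_ge0.
  apply: eq_fsbigr => r rhn.
  have [m [_ ->]] : exists m, setT m /\ r = h n m.
    by move: rhn; rewrite inE => -[m _ <-]; exists m.
  under eq_integral do rewrite EFinM.
  under [RHS]eq_integral do rewrite EFinM -muleA.
  rewrite !ge0_integralZl//.
  - rewrite integral_indic// setIT nuE//; congr *%E.
    rewrite integral_mkcond; apply: eq_integral => x _.
    by rewrite patchE indicE; case: ifP => _; rewrite ?mul1e ?mul0e.
  - apply: emeasurable_funM; exact/measurable_EFinP.
  - by move=> x _; rewrite mule_ge0 ?lee_fin.
  - by rewrite lee_fin.
  - exact/measurable_EFinP.
  - by rewrite lee_fin.
have EE : (fun n => \int[nu]_x (EFin \o h n) x) =
          (fun n => \int[mu]_x ((h n x)%:E * (g x)%:E)).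
  by apply/funext => k; exact: E.
by rewrite EE in lhs; exact: (cvg_unique _ lhs rhs).
Qed.

Lemma integral_density (f : T -> R) : measurable_fun setT f ->
  mu.-integrable setT (fun x => (f x * g x)%:E) ->
  nu.-integrable setT (EFin \o f) /\
  \int[nu]_x (f x)%:E = \int[mu]_x (f x * g x)%:E.
Proof.
move=> mf ifg.
have mEf : measurable_fun setT (EFin \o f) by exact/measurable_EFinP.
have [_ fgy] := integrableP _ _ _ ifg.
have inu : nu.-integrable setT (EFin \o f).
  apply/integrableP; split=> //.
  rewrite ge0_integral_density//; last exact: measurableT_comp.
  move: fgy; congr (_ < _); apply: eq_integral => x _ /=.
  by rewrite normrM EFinM (ger0_norm (g0 x)).
split=> //; rewrite integralE [RHS]integralE.
rewrite !ge0_integral_density//; [|exact: measurable_funeneg|exact: measurable_funepos].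
congr (_ - _); apply: eq_integral => x _.
  by rewrite !funeposE -!EFin_max -EFinM maxr_pMl// mul0r.
by rewrite !funenegE -!EFinN -!EFin_max -EFinM maxr_pMl// mul0r mulNr.
Qed.

End density.

Section whole_line.
Context (R : realType).
Local Notation mu := (@lebesgue_measure R).

(** The fundamental theorem of calculus on [-n, n], with n tending to infinity. *)
Lemma integral_derive_eq0 (F f : R -> R) :
  (forall x, is_derive x (1 : R) F (f x)) -> continuous f ->
  mu.-integrable setT (EFin \o f) ->
  F n.+1%:R @[n --> \oo] --> 0 -> F (- n.+1%:R) @[n --> \oo] --> 0 ->
  (\int[mu]_x (f x)%:E = 0)%E.
Proof.
move=> dF cf intf Fy FNy.
pose I n : set R := `[- n.+1%:R, n.+1%:R]%classic.
have mI n : measurable (I n) by exact: measurable_itv.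
have ftc n : (\int[mu]_(x in I n) (f x)%:E = (F n.+1%:R - F (- n.+1%:R))%:E)%E.
  rewrite EFinB /I; apply: continuous_FTC2.
  - by rewrite -subr_gt0 opprK.
  - exact: continuous_subspaceT.
  - have cF : continuous F.
      by move=> x; apply/differentiable_continuous/derivable1_diffP; exact: ex_derive.
    split; first by move=> x _; exact: ex_derive.
    + by apply: cvg_at_right_filter; exact: cF.
    + by apply: cvg_at_left_filter; exact: cF.
  - by move=> x _; rewrite derive1E derive_val.
have lim0 : (\int[mu]_(x in I n) (f x)%:E @[n --> \oo] --> 0)%E.
  under eq_fun do rewrite ftc.
  apply/fine_cvgP; split; first exact: nearW.
  rewrite [X in _ --> X](_ : _ = 0 - 0); last by rewrite subr0.
  exact: cvgB.
have limf : (\int[mu]_(x in I n) (f x)%:E @[n --> \oo] --> \int[mu]_x (f x)%:E)%E.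
  under eq_fun do rewrite integral_mkcond.
  apply: (@dominated_cvg _ _ _ mu setT _ _ _ (fun x => `|(f x)%:E|)%E) => //=.
  - move=> n; apply/(measurable_restrictT _ (mI n)); apply/measurable_EFinP.
    by apply: measurable_funTS; exact: continuous_measurable_fun.
  - move=> x _; apply: cvg_near_cst.
    exists (Num.truncn `|x|) => // n /= xn.
    rewrite patchE mem_set// /I /= in_itv/= -ler_norml ltW//.
    by rewrite (lt_le_trans (truncnS_gt _))// ler_nat ltnS.
  - exact: integrable_norm.
  - move=> n x _; rewrite patchE; case: ifP => _; first exact: lexx.
    by rewrite /= normr0 lee_fin.
exact: (cvg_unique _ limf lim0).
Qed.

End whole_line.

Section normal_integrals.
Context (R : realType) (m s : R) (s0 : s != 0).
Local Notation mu := (@lebesgue_measure R).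
Local Notation p := (normal_pdf m s).
Local Notation N := (normal_prob m s).

Lemma is_derive_normal_pdf x :
  is_derive x (1 : R) p (- ((x - m) / s ^+ 2) * p x).
Proof.
have -> : p = (fun x => normal_peak s * normal_fun m s x).
  by apply/funext => y; rewrite normal_pdfE.
rewrite /normal_fun.
apply: is_derive_eq.
rewrite /GRing.scale/=; move: (expR _) => e.
by field.
Qed.

Let normal_pdf_gauss (t x : R) : t != 0 ->
  normal_pdf m t x = normal_peak t * expR (- ((x - m) ^+ 2 / (t ^+ 2 * 2))).
Proof.
by move=> t0; rewrite normal_pdfE// /normal_fun mulNr -mulr_natr.
Qed.

(** Each power of the argument can be absorbed by a fraction of the exponent. *)
Let mulexpN (u : R) : u * expR (- u) <= 1.
Proof.
rewrite -ler_pdivlMr ?expR_gt0// expRN mul1r invrK.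
by rewrite (le_trans _ (expR_ge1Dx _))// lerDr.
Qed.

(** Comparison with the density of twice the standard deviation: the quadratic
    factor is absorbed by three quarters of the exponent. *)
Lemma integrable_sqr_normal_pdf :
  mu.-integrable setT (fun x => ((x - m) ^+ 2 * p x)%:E).
Proof.
have s20 : 2 * s != 0 by rewrite mulf_neq0.
pose C := 8 / 3 * s ^+ 2 * normal_peak s / normal_peak (2 * s).
have C0 : 0 <= C.
  rewrite divr_ge0 ?normal_peak_ge0// mulr_ge0 ?normal_peak_ge0//.
  by rewrite mulr_ge0 ?sqr_ge0.
apply: (@le_integrable _ _ _ mu setT _ _
    (fun x => C%:E * (normal_pdf m (2 * s) x)%:E)%E) => //.
- apply/measurable_EFinP; apply: measurable_funM; last exact: measurable_normal_pdf.
  by apply: measurable_funX; exact: measurable_funB.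
- move=> x _; rewrite -EFinM /abse lee_fin !ger0_norm; last 2 first.
  + by apply: mulr_ge0; last exact: normal_pdf_ge0.
  + by rewrite mulr_ge0 ?normal_pdf_ge0 ?sqr_ge0.
  rewrite !normal_pdf_gauss// /C; set y := (x - m) ^+ 2.
  set u := 3 / 8 * (y / s ^+ 2).
  have -> : expR (- (y / (s ^+ 2 * 2))) =
            expR (- u) * expR (- (y / ((2 * s) ^+ 2 * 2))).
    by rewrite -expRD; congr expR; rewrite /u; field.
  have -> : y = 8 / 3 * s ^+ 2 * u by rewrite /u; field.
  have pk : normal_peak (2 * s) != 0 by rewrite gt_eqF// normal_peak_gt0.
  rewrite [leLHS](_ : _ = (u * expR (- u)) * (8 / 3 * s ^+ 2 * normal_peak s *
    expR (- (8 / 3 * s ^+ 2 * u / ((2 * s) ^+ 2 * 2))))); last by ring.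
  rewrite [leRHS](_ : _ = (8 / 3 * s ^+ 2 * normal_peak s *
    expR (- (8 / 3 * s ^+ 2 * u / ((2 * s) ^+ 2 * 2))))); last first.
    by move: (expR _) => e; field.
  apply: ler_piMl; last exact: mulexpN.
  rewrite mulr_ge0 ?expR_ge0// mulr_ge0 ?normal_peak_ge0//.
  by rewrite mulr_ge0 ?sqr_ge0.
- by apply: integrableZl => //; exact: integrable_normal_pdf.
Qed.

Lemma integrable_poly_normal_pdf (g : R -> R) (C : R) :
  measurable_fun setT g -> (forall x, `|g x| <= C * (1 + (x - m) ^+ 2)) ->
  mu.-integrable setT (fun x => (g x * p x)%:E).
Proof.
move=> mg gC.
apply: (@le_integrable _ _ _ mu setT _ _
    (fun x => C%:E * ((p x)%:E + ((x - m) ^+ 2 * p x)%:E))%E) => //.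
- apply/measurable_EFinP; apply: measurable_funM => //.
  exact: measurable_normal_pdf.
- move=> x _; rewrite -EFinD -EFinM /abse lee_fin (le_trans _ (ler_norm _))//.
  rewrite normrM (ger0_norm (normal_pdf_ge0 m s x)).
  rewrite (_ : C * (_ + _) = C * (1 + (x - m) ^+ 2) * p x); last by ring.
  by rewrite ler_wpM2r ?normal_pdf_ge0.
- apply: integrableZl => //; apply: integrableD => //.
    exact: integrable_normal_pdf.
  exact: integrable_sqr_normal_pdf.
Qed.

Let normal_pdf_tail (g : R -> R) (C : R) : 0 <= C ->
  (forall x, `|g x| <= C * (1 + `|x - m|)) ->
  exists D, forall x, `|g x * p x| <= D / (1 + `|x - m|).
Proof.
move=> C0 gC; exists (C * (2 * (1 + 2 * s ^+ 2)) * normal_peak s) => x.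
have z1 : 0 < 1 + `|x - m| by rewrite ltr_pwDl.
rewrite ler_pdivlMr// normrM (ger0_norm (normal_pdf_ge0 _ _ _)).
rewrite normal_pdf_gauss//; set e := expR _.
have e0 : 0 <= e by exact: expR_ge0.
have e1 : e <= 1.
  rewrite -[leRHS]expR0 ler_expR oppr_le0 divr_ge0 ?sqr_ge0//.
  by rewrite mulr_ge0 ?sqr_ge0.
have ze : (x - m) ^+ 2 * e <= 2 * s ^+ 2.
  have := mulexpN ((x - m) ^+ 2 / (s ^+ 2 * 2)); rewrite -/e.
  rewrite -(ler_pM2l (_ : 0 < 2 * s ^+ 2)); last by rewrite mulr_gt0 ?exprn_even_gt0.
  by congr (_ <= _); [field|rewrite mulr1].
have zz : (1 + `|x - m|) ^+ 2 <= 2 * (1 + (x - m) ^+ 2).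
  rewrite -(real_normK (num_real (x - m))).
  by have := sqr_ge0 (1 - `|x - m|); nra.
apply: (@le_trans _ _ (C * (1 + `|x - m|) * (normal_peak s * e) * (1 + `|x - m|))).
  by rewrite !ler_wpM2r ?(ltW z1) ?mulr_ge0 ?normal_peak_ge0.
rewrite (_ : _ * _ = C * ((1 + `|x - m|) ^+ 2 * e) * normal_peak s); last by ring.
rewrite ler_wpM2r ?normal_peak_ge0// ler_wpM2l//.
by rewrite (@le_trans _ _ (2 * (1 + (x - m) ^+ 2) * e)) ?ler_wpM2r//; nra.
Qed.

Let cvg_tail (D : R) (x_ : nat -> R) : (forall n, n%:R <= `|x_ n|) ->
  D / (1 + `|x_ n - m|) @[n --> \oo] --> 0.
Proof.
move=> xn; rewrite -(mulr0 D); apply: cvgM; first exact: cvg_cst.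
apply/cvgrPdist_lt => e e0; near=> n.
rewrite sub0r normrN ger0_norm ?invr_ge0 ?addr_ge0//.
rewrite invf_plt ?posrE ?ltr_pwDl//.
have h : e^-1 + `|m| < n%:R.
  near: n; exists (Num.truncn (e^-1 + `|m|)).+1 => // k /= kn.
  by rewrite (lt_le_trans (truncnS_gt _))// ler_nat.
have := xn n; have := ler_normD (x_ n - m) m; rewrite subrK; lra.
Unshelve. all: by end_near. Qed.

(** Integration by parts against the normal density, whose logarithmic
    derivative is [- (x - m) / s ^+ 2]. Applied to a constant, to [x - m] and to
    a sine it yields the mean, the variance and the characteristic function. *)
Lemma stein (g g' : R -> R) (C : R) :
  (forall x, is_derive x (1 : R) g (g' x)) -> continuous g' -> 0 <= C ->
  (forall x, `|g x| <= C * (1 + `|x - m|)) ->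
  (forall x, `|g' x| <= C * (1 + `|x - m|)) ->
  (\int[mu]_x (g' x * p x)%:E = \int[mu]_x (((x - m) / s ^+ 2 * g x) * p x)%:E)%E.
Proof.
move=> dg cg' C0 gC g'C.
have cg : continuous g.
  by move=> x; apply/differentiable_continuous/derivable1_diffP; exact: ex_derive.
have z2 x : `|x - m| <= 1 + (x - m) ^+ 2.
  rewrite -(real_normK (num_real (x - m))).
  by have := sqr_ge0 (1 - `|x - m|); have := normr_ge0 (x - m); nra.
have ig' : mu.-integrable setT (fun x => (g' x * p x)%:E).
  apply: (@integrable_poly_normal_pdf _ (2 * C)).
    exact: continuous_measurable_fun.
  move=> x; rewrite (le_trans (g'C x))// (mulrC 2) -[leRHS]mulrA ler_wpM2l//.
  by have := z2 x; have := sqr_ge0 (x - m); lra.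
have igz : mu.-integrable setT (fun x => ((x - m) / s ^+ 2 * g x * p x)%:E).
  apply: (@integrable_poly_normal_pdf _ (2 * C / s ^+ 2)).
    apply: measurable_funM; last exact: continuous_measurable_fun.
    by apply: measurable_funM => //; exact: measurable_funB.
  move=> x; rewrite normrM normrM [`|_^-1|]ger0_norm ?invr_ge0 ?sqr_ge0//.
  rewrite [leLHS]mulrAC [leRHS]mulrAC ler_wpM2r ?invr_ge0 ?sqr_ge0//.
  rewrite (@le_trans _ _ (`|x - m| * (C * (1 + `|x - m|))))//.
    by rewrite ler_wpM2l.
  rewrite (_ : 2 * C * _ = C * (2 * (1 + (x - m) ^+ 2))) 1?mulrCA; last by ring.
  rewrite ler_wpM2l// mulrDr mulr1 -expr2.
  rewrite real_normK ?num_real//.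
  by have := z2 x; have := sqr_ge0 (x - m); lra.
pose F x := g x * p x.
pose f x := g' x * p x - (x - m) / s ^+ 2 * g x * p x.
have [D FD] := normal_pdf_tail C0 gC.
have : (\int[mu]_x (f x)%:E = 0)%E.
  apply: (@integral_derive_eq0 R F f).
  - move=> x; rewrite /F; have h1 := dg x; have h2 := is_derive_normal_pdf x.
    by apply: is_derive_eq; rewrite /GRing.scale/= /f; ring.
  - move=> x; apply: cvgB.
      by apply: cvgM; [exact: cg'|exact: continuous_normal_pdf].
    apply: cvgM; last exact: continuous_normal_pdf.
    apply: cvgM; last exact: cg.
    apply: cvgM; last exact: cvg_cst.
    by apply: cvgB; [exact: cvg_id|exact: cvg_cst].
  - rewrite (_ : EFin \o f = fun x =>
        ((g' x * p x)%:E - ((x - m) / s ^+ 2 * g x * p x)%:E)%E).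
      exact: integrableB.
    by apply/funext => x.
  - apply: norm_cvg0.
    apply: (@squeeze_cvgr _ _ _ _ (fun=> 0) (fun n => D / (1 + `|n.+1%:R - m|))).
    + by apply: nearW => n; rewrite normr_ge0 FD.
    + exact: cvg_cst.
    + apply: (cvg_tail D) => n; rewrite ger0_norm// ler_nat.
      exact: leqnSn.
  - apply: norm_cvg0.
    apply: (@squeeze_cvgr _ _ _ _ (fun=> 0) (fun n => D / (1 + `|- n.+1%:R - m|))).
    + by apply: nearW => n; rewrite normr_ge0 FD.
    + exact: cvg_cst.
    + apply: (cvg_tail D) => n; rewrite normrN ger0_norm// ler_nat.
      exact: leqnSn.
rewrite /f; under eq_integral do rewrite EFinB.
rewrite integralB// => /eqP.
rewrite sube_eq ?add0e; last 2 first.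
- exact: integrable_fin_num.
- by rewrite fin_num_adde_defr//; exact: integrable_fin_num.
by move=> /eqP.
Qed.

End normal_integrals.

Section normal_moments.
Context (R : realType) (m s : R) (s0 : s != 0).
Local Notation mu := (@lebesgue_measure R).
Local Notation p := (normal_pdf m s).
Local Notation N := (normal_prob m s).

Let N_density A : measurable A -> N A = (\int[mu]_(x in A) (p x)%:E)%E.
Proof. by []. Qed.

Let intN (g : R -> R) (C : R) : measurable_fun setT g ->
  (forall x, `|g x| <= C * (1 + (x - m) ^+ 2)) ->
  N.-integrable setT (EFin \o g) /\
  (\int[N]_x (g x)%:E = \int[mu]_x (g x * p x)%:E)%E.
Proof.
move=> mg gC.
apply: (@integral_density R _ _ mu N p (measurable_normal_pdf m s)
  (normal_pdf_ge0 m s) N_density g mg).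
exact: integrable_poly_normal_pdf gC.
Qed.

Lemma normal_integrable_sqr :
  N.-integrable setT (EFin \o (fun x => (x - m) ^+ 2)).
Proof.
apply: (intN (C := 1) _ _).1.
  by apply: measurable_funX; exact: measurable_funB.
by move=> x; rewrite mul1r ger0_norm ?sqr_ge0// lerDr.
Qed.

Let s2_ge0 : 0 <= s ^+ 2. Proof. exact: sqr_ge0. Qed.

Let z_bound x : `|x - m| <= 1 * (1 + (x - m) ^+ 2).
Proof.
rewrite mul1r -(real_normK (num_real (x - m))).
by have := sqr_ge0 (1 - `|x - m|); have := normr_ge0 (x - m); nra.
Qed.

Let le_lin C x : 0 <= C -> C <= C * (1 + `|x - m|).
Proof. by move=> C0; rewrite ler_peMr// lerDl. Qed.

Let s2K x (g : R) : (x - m) / s ^+ 2 * (s ^+ 2 * g) = (x - m) * g.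
Proof. by field. Qed.

Lemma normal_mean :
  N.-integrable setT (EFin \o (fun x => x - m)) /\ (\int[N]_x (x - m)%:E = 0)%E.
Proof.
have [|-> ->] := intN _ z_bound; first exact: measurable_funB.
split=> //.
transitivity (\int[mu]_x (((x - m) / s ^+ 2 * (s ^+ 2 * 1)) * p x)%:E)%E.
  by apply: eq_integral => x _; rewrite s2K mulr1.
rewrite -(@stein R m s s0 (fun=> s ^+ 2 * 1) (fun=> 0) (s ^+ 2)) //.
- by under eq_integral do rewrite mul0r; rewrite integral0.
- by move=> x; exact: cvg_cst.
- by move=> x; rewrite mulr1 ger0_norm// le_lin.
- by move=> x; rewrite normr0 mulr_ge0// addr_ge0.
Qed.

Lemma normal_variance : (\int[N]_x ((x - m) ^+ 2)%:E = (s ^+ 2)%:E)%E.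
Proof.
have [||_ ->] := @intN (fun x => (x - m) ^+ 2) 1.
- by apply: measurable_funX; exact: measurable_funB.
- by move=> x; rewrite mul1r ger0_norm ?sqr_ge0// lerDr.
have dg x : is_derive x (1 : R) (fun x => s ^+ 2 * (x - m)) (s ^+ 2).
  by apply: is_derive_eq; rewrite /GRing.scale/=; ring.
have st := stein s0 (C := s ^+ 2) dg _ s2_ge0.
transitivity (\int[mu]_x (((x - m) / s ^+ 2 * (s ^+ 2 * (x - m))) * p x)%:E)%E.
  by apply: eq_integral => x _; rewrite s2K -expr2.
rewrite -st.
- under eq_integral do rewrite EFinM.
  rewrite integralZl//; last exact: integrable_normal_pdf.
  by rewrite integral_normal_pdf mule1.
- by move=> x; exact: cvg_cst.
- by move=> x; rewrite normrM ger0_norm// ler_wpM2l// lerDr.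
- by move=> x; rewrite ger0_norm// le_lin.
Qed.

Let is_derive_lin (t b x : R) : is_derive x (1 : R) (fun x => t * (x - m) + b) t.
Proof. by apply: is_derive_eq; rewrite /GRing.scale/=; ring. Qed.

Let measurable_lin (t b : R) : measurable_fun setT (fun x : R => t * (x - m) + b).
Proof.
by apply: measurable_funD => //; apply: measurable_funM => //; exact: measurable_funB.
Qed.

Let measurable_sin (t b : R) : measurable_fun setT (fun x : R => sin (t * (x - m) + b)).
Proof.
apply: (measurableT_comp (f := @sin R)); last exact: measurable_lin.
by apply: continuous_measurable_fun; exact: continuous_sin.
Qed.

Let integrable_sin (t b : R) :
  N.-integrable setT (EFin \o (fun x => (x - m) * sin (t * (x - m) + b))) /\
  (\int[N]_x ((x - m) * sin (t * (x - m) + b))%:E =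
   \int[mu]_x ((x - m) * sin (t * (x - m) + b) * p x)%:E)%E.
Proof.
apply: (@intN _ 1).
  by apply: measurable_funM => //; exact: measurable_funB.
move=> x; rewrite (le_trans _ (z_bound x))// normrM ler_piMr//.
by rewrite ler_norml sin_geN1 sin_le1.
Qed.

Lemma stein_sin (t b : R) : \int[N]_x ((x - m) * sin (t * (x - m) + b)) =
  s ^+ 2 * t * \int[N]_x cos (t * (x - m) + b).
Proof.
have bcosN : bounded_mfun (fun x : R => cos (t * (x - m) + b)).
  exact: bounded_mfun_cos.
rewrite -Rintegral_boundedZ// /Rintegral (integrable_sin t b).2.
have [||_ ->] := @intN (fun x => s ^+ 2 * t * cos (t * (x - m) + b)) (s ^+ 2 * `|t|).
- by apply: measurable_funM => //; case: bcosN.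
- move=> x; rewrite normrM; apply: ler_pM => //.
    by rewrite normrM (ger0_norm s2_ge0).
  apply: (@le_trans _ _ 1); last by rewrite lerDl sqr_ge0.
  by rewrite ler_norml cos_geN1 cos_le1.
have C0 : 0 <= s ^+ 2 * (1 + `|t|) by rewrite mulr_ge0// addr_ge0.
have dg x : is_derive x (1 : R) (fun x => s ^+ 2 * sin (t * (x - m) + b))
    (s ^+ 2 * t * cos (t * (x - m) + b)).
  have dl := is_derive_lin t b x.
  by apply: is_derive_eq; rewrite /GRing.scale/=; ring.
have st := stein s0 (C := s ^+ 2 * (1 + `|t|)) dg _ C0.
rewrite st.
- by congr fine; apply: eq_integral => x _; rewrite s2K.
- move=> x; apply: cvgM; first exact: cvg_cst.
  apply: continuous_comp; last exact: continuous_cos.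
  by apply/differentiable_continuous/derivable1_diffP; exact: ex_derive.
- move=> x; rewrite (le_trans _ (le_lin _ C0))// normrM ger0_norm// ler_wpM2l//.
  by rewrite (@le_trans _ _ 1) ?lerDl// ler_norml sin_geN1 sin_le1.
- move=> x; rewrite (le_trans _ (le_lin _ C0))// -mulrA normrM ger0_norm// ler_wpM2l//.
  rewrite normrM (@le_trans _ _ `|t|) ?lerDr// ler_piMr//.
  by rewrite ler_norml cos_geN1 cos_le1.
Qed.

Let c (b t : R) := \int[N]_x cos (t * (x - m) + b).

Let is_derive_c (b t : R) : is_derive t (1 : R) (c b) (- (s ^+ 2 * t) * c b t).
Proof.
pose f (t x : R) := cos (t * (x - m) + b).
have df (x u : R) : is_derive u (1 : R) (f ^~ x) (- ((x - m) * sin (u * (x - m) + b))).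
  have dl : is_derive u (1 : R) (fun u => u * (x - m) + b) (x - m).
    by apply: is_derive_eq; rewrite /GRing.scale/=; ring.
  by rewrite /f; apply: is_derive_eq; rewrite /GRing.scale/=; ring.
have d1f u x : partial1of2 f u x = - ((x - m) * sin (u * (x - m) + b)).
  by rewrite partial1of2E; exact: derive_val.
have It : (`]t - 1, t + 1[%classic : set R) t.
  by rewrite /= in_itv/=; apply/andP; split; lra.
have intf u : (`]t - 1, t + 1[%classic : set R) u -> N.-integrable setT (EFin \o f u).
  move=> _; apply: bounded_mfun_integrable; apply: bounded_mfun_cos.
  exact: measurable_lin.
have derf u x : (`]t - 1, t + 1[%classic : set R) u -> setT x -> derivable (f ^~ x) u 1.
  by move=> _ _; exact: ex_derive.
have intG : N.-integrable setT (EFin \o (fun x => `|x - m|)).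
  exact: (integrable_norm normal_mean.1).
have G_ub u x : (`]t - 1, t + 1[%classic : set R) u -> setT x ->
    `|partial1of2 f u x| <= `|x - m|.
  move=> _ _; rewrite d1f normrN normrM ler_piMr//.
  by rewrite ler_norml sin_geN1 sin_le1.
have G0 (x : R) : 0 <= `|x - m| by [].
have dc := derivable_under_integral measurableT It intf derf G0 intG G_ub.
have cE := differentiation_under_integral measurableT It intf derf G0 intG G_ub.
apply: DeriveDef => //; rewrite -derive1E [LHS]cE.
under eq_Rintegral do rewrite d1f -mulN1r.
rewrite RintegralZl//; last exact: (integrable_sin t b).1.
by rewrite stein_sin mulN1r mulNr.
Qed.

(** By Stein's identity the left-hand side, as a function of [t], satisfies the
    differential equation [c' = - s ^+ 2 * t * c]; so its product with
    [expR (s ^+ 2 * t ^+ 2 / 2)] is constant. *)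
Lemma normal_cos_lin (t b : R) :
  \int[N]_x cos (t * (x - m) + b) = expR (- (s ^+ 2 * t ^+ 2 / 2)) * cos b.
Proof.
pose D t := c b t * expR (s ^+ 2 * t ^+ 2 / 2).
have dD u : is_derive u (1 : R) D 0.
  have h1 := is_derive_c b u; rewrite /D.
  by apply: is_derive_eq; rewrite /GRing.scale/=; field.
have := is_derive_0_is_cst t 0 dD.
rewrite /D expr0n/= mulr0 mul0r expR0 mulr1.
have -> : c b 0 = cos b.
  rewrite /c; under eq_Rintegral do rewrite mul0r add0r.
  exact: Rintegral_prob_cst.
by move=> <-; rewrite [RHS]mulrCA -expRD addNr expR0 mulr1.
Qed.

Lemma normal_cos (b : R) :
  \int[N]_x cos (x + b) = expR (- (s ^+ 2 / 2)) * cos (m + b).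
Proof.
have := normal_cos_lin 1 (m + b); rewrite expr1n mulr1 => <-.
by apply: eq_Rintegral => x _; congr cos; ring.
Qed.

End normal_moments.

Section gaussian_variable.
Context (R : realType) (d : measure_display) (T : measurableType d).
Context (P : probability T R) (U : T -> R) (mU : measurable_fun setT U).

(* the normal law is defined on [measurableTypeR R], whose display is not that
   of [R] although its measurable sets are the same *)
Let mU' : @measurable_fun _ _ T (measurableTypeR R) setT U := mU.
Let U_mixin := isMeasurableFun.Build _ _ _ _ _ mU'.
Let Uf : {mfun T >-> measurableTypeR R} := HB.pack U U_mixin.

Section transfer.
Context (nu : {measure set (measurableTypeR R) -> \bar R}).
Hypothesis lawU : forall B : set R, measurable B -> P (U @^-1` B) = nu B.

Lemma integral_of_law (f : R -> R) : measurable_fun setT f ->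
  nu.-integrable setT (EFin \o f) ->
  P.-integrable setT (EFin \o (f \o U)) /\
  (\int[P]_w (f (U w))%:E = \int[nu]_x (f x)%:E)%E.
Proof.
move=> mf intf.
have mEf : measurable_fun setT (EFin \o f) by exact/measurable_EFinP.
have tr (g : measurableTypeR R -> \bar R) :
    (\int[nu]_x g x = \int[distribution P Uf]_x g x)%E.
  by apply: eq_measure_integral => B mB _; rewrite -lawU.
have intP : P.-integrable setT (EFin \o (f \o U)).
  have /integrableP[_ fy] := intf.
  apply/integrableP; split; first by apply/measurable_EFinP; exact: measurableT_comp.
  apply: le_lt_trans fy.
  rewrite tr ge0_integral_pushforward//.
  exact: measurableT_comp.
split=> //.
by rewrite tr integral_pushforward.
Qed.

End transfer.

Variables (m s : R).
Hypothesis lawU : forall B : set R, measurable B -> P (U @^-1` B) = gaussian_law m s B.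

Lemma gaussian_variable_moments :
  [/\ P.-integrable setT (EFin \o (fun w => (U w - m) ^+ 2)),
      P.-integrable setT (EFin \o (fun w => U w - m)),
      (\int[P]_w (U w - m)%:E = 0)%E,
      (\int[P]_w ((U w - m) ^+ 2)%:E = (s ^+ 2)%:E)%E &
      forall b, \int[P]_w cos (U w + b) = expR (- (s ^+ 2 / 2)) * cos (m + b)].
Proof.
have m1 : measurable_fun setT (fun x : R => x - m) by exact: measurable_funB.
have m2 : measurable_fun setT (fun x : R => (x - m) ^+ 2) by exact: measurable_funX.
have m3 b : measurable_fun setT (fun x : R => cos (x + b)).
  suff [] : bounded_mfun (fun x : R => cos (x + b)) by [].
  by apply: bounded_mfun_cos; exact: measurable_funD.
move: lawU; rewrite /gaussian_law; have [s0|s0] := eqVneq s 0 => law.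
  pose dm : {measure set (measurableTypeR R) -> \bar R} :=
    @dirac _ (measurableTypeR R) m R.
  have law' : forall B : set R, measurable B -> P (U @^-1` B) = dm B by [].
  have int1 (f : R -> R) : measurable_fun setT f ->
     dm.-integrable setT (EFin \o f).
    move=> mf; have mEf : @measurable_fun _ _ (measurableTypeR R) _ setT (EFin \o f).
      by apply/measurable_EFinP; exact: mf.
    apply/integrableP; split=> //.
    rewrite [X in (X < _)%E](@integral_dirac _ (measurableTypeR R) m R setT)//.
      by rewrite diracT mul1e ltry.
    exact: (measurableT_comp (@abse_measurable _ _)).
  have E (f : R -> R) : measurable_fun setT f ->
      P.-integrable setT (EFin \o (f \o U)) /\ (\int[P]_w (f (U w))%:E = (f m)%:E)%E.
    move=> mf; have [i1 ->] := integral_of_law law' mf (int1 _ mf); split => //.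
    rewrite [LHS](@integral_dirac _ (measurableTypeR R) m R setT)//.
      by rewrite diracT mul1e.
    by apply/measurable_EFinP; exact: mf.
  split.
  - exact: (E _ m2).1.
  - exact: (E _ m1).1.
  - by rewrite (E _ m1).2 subrr.
  - by rewrite (E _ m2).2 subrr s0 expr0n.
  - by move=> b; rewrite /Rintegral (E _ (m3 b)).2 s0 expr0n/= mul0r oppr0 expR0 mul1r.
pose nm : {measure set (measurableTypeR R) -> \bar R} := normal_prob m s.
have law' : forall B : set R, measurable B -> P (U @^-1` B) = nm B by [].
have [i1 e1] := integral_of_law law' m1 (normal_mean m s0).1.
have [i2 e2] := integral_of_law law' m2 (normal_integrable_sqr m s0).
split=> //; first by rewrite e1 (normal_mean m s0).2.
  by rewrite e2 normal_variance.
move=> b; rewrite -normal_cos// /Rintegral.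
have [|_ ->//] := integral_of_law law' (m3 b).
by apply: bounded_mfun_integrable; apply: bounded_mfun_cos; exact: measurable_funD.
Qed.

End gaussian_variable.

(** * Gaussian concentration *)
Section one_dimensional.
Context (R : realType).
Local Notation mu := (@lebesgue_measure R).
Implicit Types (f g h : R -> R) (A B H : set R).

(** Tonelli's theorem for the indicator of the region under the graph. *)
Lemma layer_cake f : measurable_fun setT f -> (forall x, 0 <= f x) ->
  (\int[mu]_x (f x)%:E = \int[mu]_(t in `]0%R, +oo[) mu [set x | (t < f x)%R])%E.
Proof.
move=> mf f0.
pose k (z : R * R) : R := \1_[set z : R * R | (0 < z.2) && (z.2 < f z.1)] z.
have mk : measurable_fun setT (EFin \o k).
  apply/measurable_EFinP; apply: measurable_indic.
  have m1 : measurable_fun setT (fun z : R * R => (0 < z.2) && (z.2 < f z.1)).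
    apply: measurable_and; apply: measurable_fun_ltr => //.
    exact: measurableT_comp.
  by have := m1 measurableT [set true] I; rewrite setTI.
have := @fubini_tonelli _ _ _ _ R mu mu (EFin \o k) mk.
have k0 z : (0 <= (EFin \o k) z)%E by rewrite lee_fin /k indicE.
move=> /(_ k0) E.
transitivity (\int[mu]_x \int[mu]_t (EFin \o k) (x, t))%E.
  apply: eq_integral => x _.
  rewrite [RHS](_ : _ =
    (\int[mu]_t (\1_(`]0, f x[%classic : set R) t)%:E)%E); last first.
    apply: eq_integral => t _; rewrite /= /k !indicE; congr (nat_of_bool _)%:R%:E.
  rewrite integral_indic// setIT [RHS](lebesgue_measure_itv `]0, f x[) /= lte_fin.
  case: ltP => [_|fx0]; first by rewrite oppr0 adde0.
  by congr EFin; apply/eqP; rewrite eq_le fx0 f0.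
rewrite E [RHS]integral_mkcond; apply: eq_integral => t _.
rewrite patchE (_ : (t \in _) = (0 < t)); last first.
  by apply/idP/idP; rewrite inE/= in_itv/= andbT.
case: ifPn => t0.
  rewrite [LHS](_ : _ = (\int[mu]_x (\1_[set x | t < f x] x)%:E)%E).
    rewrite integral_indic ?setIT//.
    have := measurable_fun_ltr (measurable_cst t) mf.
    by move=> /(_ measurableT [set true] I); rewrite setTI.
  apply: eq_integral => x _; rewrite /= /k !indicE; congr (nat_of_bool _)%:R%:E.
  by apply/idP/idP; rewrite !inE /= t0.
transitivity (\int[mu]_x (0 : \bar R))%E; last by rewrite integral0.
apply: eq_integral => x _; rewrite /= /k indicE memNset//=.
by rewrite (negbTE t0).
Qed.

(** The Brunn-Minkowski inequality on the line, for midpoints confined to a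
    centred interval: each set lies between its infimum and its supremum, and
    the midpoints of the infima and of the suprema lie in the closed
    interval. *)
Lemma lebesgue_midpoint (A B : set R) (r : R) : 0 <= r ->
  measurable A -> measurable B -> A !=set0 -> B !=set0 ->
  (forall x y, A x -> B y -> `|x + y| <= 2 * r) ->
  (mu A + mu B <= 2%:E * (2 * r)%:E)%E.
Proof.
move=> r0 mA mB [a0 Aa0] [b0 Bb0] AB.
have bd x y : A x -> B y -> - (2 * r) <= x + y <= 2 * r.
  by move=> Ax By; rewrite -ler_norml AB.
have uA : has_ubound A by exists (2 * r - b0) => x Ax; have := bd _ _ Ax Bb0; lra.
have lA : has_lbound A by exists (- (2 * r) - b0) => x Ax; have := bd _ _ Ax Bb0; lra.
have uB : has_ubound B by exists (2 * r - a0) => x Bx; have := bd _ _ Aa0 Bx; lra.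
have lB : has_lbound B by exists (- (2 * r) - a0) => x Bx; have := bd _ _ Aa0 Bx; lra.
have hull (C : set R) : measurable C -> C !=set0 -> has_ubound C -> has_lbound C ->
    (mu C <= (sup C - inf C)%:E)%E.
  move=> mC [c Cc] uC lC.
  have ic : inf C <= sup C by rewrite (@le_trans _ _ c)// ?ge_inf// ub_le_sup.
  rewrite (@le_trans _ _ (mu `[inf C, sup C]%classic))//.
    apply: le_measure; rewrite ?inE// => x Cx; rewrite /= in_itv/=.
    by rewrite ge_inf// ub_le_sup.
  rewrite lebesgue_measure_itv/= lte_fin; case: ltP => // _.
  by rewrite lee_fin subr_ge0.
have supAB : sup A + sup B <= 2 * r.
  rewrite -lerBrDr; apply: ge_sup; first by exists a0.
  move=> x Ax; rewrite lerBrDr -lerBrDl; apply: ge_sup; first by exists b0.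
  by move=> y By; have := bd _ _ Ax By; lra.
have infAB : - (2 * r) <= inf A + inf B.
  rewrite -lerBlDr; apply: lb_le_inf; first by exists a0.
  move=> x Ax; rewrite lerBlDr -lerBlDl; apply: lb_le_inf; first by exists b0.
  by move=> y By; have := bd _ _ Ax By; lra.
rewrite (le_trans (leeD (hull _ mA _ uA lA) (hull _ mB _ uB lB)))//.
- by exists a0.
- by exists b0.
by rewrite -EFinD -EFinM lee_fin; lra.
Qed.

End one_dimensional.

Section prekopa_leindler_gauss.
Context (R : realType).
Local Notation mu := (@lebesgue_measure R).
Local Notation p := (normal_pdf (0 : R) 1).
Local Notation gamma := (normal_prob (0 : R) 1).
Implicit Types (f g u v : R -> R).

Lemma measurable_superlevel f t : measurable_fun setT f ->
  measurable [set x | t < f x].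
Proof.
move=> mf; have := measurable_fun_ltr (measurable_cst t) mf.
by move=> /(_ measurableT [set true] I); rewrite setTI.
Qed.

Lemma measurable_fun_superlevel f : measurable_fun setT f ->
  measurable_fun setT (fun t : R => mu [set x | t < f x]).
Proof.
move=> mf; pose A : set (R * R) := [set z | z.2 < f z.1].
have mA : measurable A.
  have m1 : measurable_fun setT (fun z : R * R => z.2 < f z.1).
    by apply: measurable_fun_ltr => //; exact: measurableT_comp.
  by have := m1 measurableT [set true] I; rewrite setTI.
have := @measurable_fun_ysection _ _ _ _ R mu A mA.
congr (measurable_fun _ _); apply/funext => t /=; congr (mu _).
by apply/seteqP; split => x; rewrite /ysection /= ?inE.
Qed.

Let p0 x : 0 < p x.
Proof. by rewrite normal_pdfE ?oner_neq0// mulr_gt0 ?expR_gt0// normal_peak_gt0. Qed.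

Let pE x : p x = normal_peak 1 * expR (- (x ^+ 2 / 2)).
Proof.
by rewrite normal_pdfE ?oner_neq0// /normal_fun subr0 expr1n mulNr.
Qed.

(** The parallelogram identity: the transport cost [(x - y) ^+ 2 / 4] is exactly
    the defect of midpoint concavity of the logarithm of the density. *)
Let p_mid (u v x y : R) : u * v <= expR ((x - y) ^+ 2 / 4) ->
  (u * p x) * (v * p y) <= p ((x + y) / 2) ^+ 2.
Proof.
move=> uv; rewrite mulrACA.
apply: (@le_trans _ _ (expR ((x - y) ^+ 2 / 4) * (p x * p y))).
  by rewrite ler_wpM2r// mulr_ge0// ltW.
rewrite !pE expr2 [leRHS]mulrACA [X in _ * X]mulrACA [leLHS]mulrCA -!expRD.
rewrite ler_wpM2l ?mulr_ge0 ?normal_peak_ge0//.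
by rewrite ler_expR; lra.
Qed.

Let superlevel_pdf (c : R) : 0 < c -> [set x | c < p x] !=set0 ->
  exists2 r : R, 0 <= r & [set x | c < p x] = `]-r, r[%classic.
Proof.
move=> c0 [x0 /= cx0].
have pk0 : 0 < normal_peak (1 : R) by rewrite normal_peak_gt0 ?oner_neq0.
pose rho := - (2 * ln (c / normal_peak 1)).
have E x : (c < p x) = (x ^+ 2 < rho).
  rewrite pE mulrC -ltr_pdivrMr// -[X in X < _]lnK ?posrE ?divr_gt0//.
  by rewrite ltr_expR /rho; apply/idP/idP; lra.
have rho0 : 0 <= rho by rewrite ltW// (le_lt_trans (sqr_ge0 x0))// -E.
exists (Num.sqrt rho); first exact: sqrtr_ge0.
apply/seteqP; split => x /=; rewrite E in_itv/= -ltr_norml -sqrtr_sqr => h.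
  by rewrite ltr_sqrt// (le_lt_trans (sqr_ge0 x)).
by move: h; apply: contraTT; rewrite -!leNgt => h; exact: ler_wsqrtr.
Qed.

(** The Prekopa-Leindler argument at one level: above a level [t] attained by
    both [f] and [g], midpoints stay above [t] for [p / k], whose superlevel
    sets are centred intervals. *)
Let superlevel_le f g (k t : R) : 0 < t ->
  measurable_fun setT f -> measurable_fun setT g ->
  (forall x y, f x * g y <= ((p ((x + y) / 2)) / k) ^+ 2) -> 0 < k ->
  (forall x, 0 <= f x) -> (forall x, 0 <= g x) ->
  [set x | t < f x] !=set0 -> [set x | t < g x] !=set0 ->
  (mu [set x | (t < f x)%R] + mu [set x | (t < g x)%R] <=
   2%:E * mu [set x | (t < p x / k)%R])%E.
Proof.
move=> t0 mf mg fg k0 f0 g0 [a fa] [b gb].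
have mid x y : t < f x -> t < g y -> t * k < p ((x + y) / 2).
  move=> tf tg; rewrite -ltr_pdivlMr//.
  have h : t * t < (p ((x + y) / 2) / k) ^+ 2.
    by rewrite (lt_le_trans _ (fg x y))// ltr_pM// ltW.
  rewrite -(ltr_pXn2r (_ : (0 < 2)%N)) ?nnegrE ?(ltW t0)//.
  by rewrite divr_ge0 ?(ltW (p0 _)) ?ltW.
have tk0 : 0 < t * k by rewrite mulr_gt0.
have [|r r0 rE] := superlevel_pdf tk0; first by exists ((a + b) / 2); exact: mid.
have -> : [set x | t < p x / k] = `]-r, r[%classic.
  by rewrite -rE; apply/seteqP; split => x /=; rewrite ltr_pdivlMr.
have -> : mu `]-r, r[%classic = (2 * r)%:E.
  rewrite lebesgue_measure_itv/= lte_fin; case: ltP => rr.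
    by rewrite -EFinD; congr EFin; lra.
  by congr EFin; lra.
apply: lebesgue_midpoint => //.
- exact: measurable_superlevel.
- exact: measurable_superlevel.
- by exists a.
- by exists b.
move=> x y fx gy; have := mid x y fx gy.
have : (`]-r, r[%classic : set R) ((x + y) / 2).
  by rewrite -rE; exact: mid.
rewrite /= in_itv/= => /andP[h1 h2] _.
by rewrite ler_norml; apply/andP; split; lra.
Qed.

Let integral_gamma u : bounded_mfun u -> (forall x, 0 <= u x) ->
  ((\int[gamma]_x u x)%:E = \int[mu]_x (u x * p x)%:E)%E.
Proof.
move=> bu u0; rewrite Rintegral_boundedE//.
have := @ge0_integral_density R _ _ mu gamma p (measurable_normal_pdf 0 1)
  (normal_pdf_ge0 0 1) (fun _ _ => erefl) (EFin \o u).
by move=> ->//; apply/measurable_EFinP; case: bu.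
Qed.

(** Maurey's property tau for the standard normal law. The densities [u * p] and
    [v * p] are normalized by their suprema [a] and [b] so that both are above
    every level below 1; integrating the inequality between superlevel sets over
    the level gives [U / a + V / b <= 2 / sqrt (a * b)], and the inequality
    between the arithmetic and geometric means finishes. *)
Lemma property_tau_line u v : bounded_mfun u -> bounded_mfun v ->
  (forall x, 0 <= u x) -> (forall x, 0 <= v x) ->
  (forall x y, u x * v y <= expR ((x - y) ^+ 2 / 4)) ->
  (\int[gamma]_x u x) * (\int[gamma]_x v x) <= 1.
Proof.
move=> bu bv u0 v0 uv.
pose f x := u x * p x; pose g x := v x * p x.
have mp : measurable_fun setT p by exact: measurable_normal_pdf.
have mf : measurable_fun setT f by apply: measurable_funM => //; case: bu.
have mg : measurable_fun setT g by apply: measurable_funM => //; case: bv.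
have f0 x : 0 <= f x by rewrite mulr_ge0// ltW.
have g0 x : 0 <= g x by rewrite mulr_ge0// ltW.
have ub w : bounded_mfun w -> has_ubound (range (fun x => w x * p x)).
  move=> [_ [C wC]]; exists (C * normal_peak 1) => _ [x _ <-].
  have px := normal_pdf_ub 0 x (oner_neq0 R).
  by rewrite (le_trans (ler_norm _))// normrM ler_pM// ger0_norm// ltW.
have nz w : bounded_mfun w -> (forall x, 0 <= w x) ->
    sup (range (fun x => w x * p x)) <= 0 ->
    \int[gamma]_x w x = 0.
  move=> bw w0 s0; transitivity (\int[gamma]_x (0 : R)); last exact: Rintegral_prob_cst.
  apply: eq_Rintegral => x _; apply/eqP.
  have : w x * p x <= 0.
    by rewrite (le_trans _ s0)//; apply: ub_le_sup; [exact: ub|exists x].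
  by rewrite pmulr_lle0// eq_le w0 andbT => ->.
have [fs0|a0] := leP (sup (range f)) 0; first by rewrite (nz u)// mul0r ler01.
have [gs0|b0] := leP (sup (range g)) 0; first by rewrite (nz v)// mulr0 ler01.
set a := sup (range f) in a0; set b := sup (range g) in b0.
pose k := Num.sqrt (a * b).
have k0 : 0 < k by rewrite sqrtr_gt0 mulr_gt0.
have k2 : k ^+ 2 = a * b by rewrite sqr_sqrtr// ltW// mulr_gt0.
have fa x : f x / a <= 1.
  by rewrite ler_pdivrMr// mul1r; apply: ub_le_sup; [exact: ub|exists x].
have gb x : g x / b <= 1.
  by rewrite ler_pdivrMr// mul1r; apply: ub_le_sup; [exact: ub|exists x].
have ne (h : R -> R) (c t : R) :
    has_ubound (range h) -> c = sup (range h) -> 0 < c -> t < 1 ->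
    [set x | t < h x / c] !=set0.
  move=> uh cE c0 t1.
  have : t * c < sup (range h) by rewrite -cE gtr_pMl.
  move=> /sup_gt [|_ [x _ <-] tx]; first by exists (h 0), 0.
  by exists x; rewrite /= ltr_pdivlMr.
have mfa : measurable_fun setT (fun x => f x / a) by exact: measurable_funM.
have mgb : measurable_fun setT (fun x => g x / b) by exact: measurable_funM.
have mpk : measurable_fun setT (fun x => p x / k) by exact: measurable_funM.
have fa0 x : 0 <= f x / a by rewrite divr_ge0// ltW.
have gb0 x : 0 <= g x / b by rewrite divr_ge0// ltW.
have pk0 x : 0 <= p x / k by rewrite divr_ge0// ltW.
have lev (t : R) : 0 < t ->
    (mu [set x | (t < f x / a)%R] + mu [set x | (t < g x / b)%R] <=
    2%:E * mu [set x | (t < p x / k)%R])%E.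
  move=> t0; have [t1|t1] := ltP t 1.
    apply: superlevel_le => //.
    - move=> x y; rewrite mulrACA -invfM -k2 expr_div_n ler_wpM2r ?invr_ge0 ?sqr_ge0//.
      exact: p_mid.
    - by apply: (ne f a) => //; exact: ub.
    - by apply: (ne g b) => //; exact: ub.
  have -> : [set x | t < f x / a] = set0.
    by apply/seteqP; split => // x /=; rewrite ltNge (le_trans (fa x) t1).
  have -> : [set x | t < g x / b] = set0.
    by apply/seteqP; split => // x /=; rewrite ltNge (le_trans (gb x) t1).
  by rewrite measure0 adde0 mule_ge0.
have tot : (\int[mu]_x (f x / a)%:E + \int[mu]_x (g x / b)%:E <=
    2%:E * \int[mu]_x (p x / k)%:E)%E.
  rewrite !layer_cake//.
  have mS (h : R -> R) : measurable_fun setT h ->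
      measurable_fun (`]0, +oo[%classic : set R) (fun t => mu [set x | t < h x]).
    by move=> mh; apply: measurable_funTS; exact: measurable_fun_superlevel.
  rewrite -ge0_integralD//; [|exact: mS|exact: mS].
  rewrite -ge0_integralZl//; last exact: mS.
  apply: ge0_le_integral => //.
  - by move=> t _; rewrite adde_ge0.
  - by apply: emeasurable_funD; exact: mS.
  - by apply: measurable_funeM; exact: mS.
  - by move=> t; rewrite /= in_itv/= andbT; exact: lev.
have Zr (h : R -> R) (c : R) : measurable_fun setT h -> (forall x, 0 <= h x) -> 0 < c ->
    (\int[mu]_x (h x / c)%:E = \int[mu]_x (h x)%:E * (c^-1)%:E)%E.
  move=> mh h0 c0; under eq_integral do rewrite EFinM.
  rewrite ge0_integralZr//; first exact/measurable_EFinP.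
  - by move=> x _; rewrite lee_fin.
  - by rewrite lee_fin invr_ge0 ltW.
move: tot; rewrite !Zr//; last by move=> x; rewrite ltW.
rewrite -!integral_gamma// integral_normal_pdf mul1e -!EFinM -EFinD lee_fin.
set U := \int[gamma]_x u x; set V := \int[gamma]_x v x => UV.
have U0 : 0 <= U by apply: Rintegral_ge0.
have V0 : 0 <= V by apply: Rintegral_ge0.
have h : (U / a) * (V / b) <= k ^- 2.
  have s1 : 4 * ((U / a) * (V / b)) <= (U / a + V / b) ^+ 2.
    by have := sqr_ge0 (U / a - V / b); nra.
  have s2 : (U / a + V / b) ^+ 2 <= (2 / k) ^+ 2.
    rewrite ler_sqr ?nnegrE//; last by rewrite divr_ge0// ltW.
    by rewrite addr_ge0// divr_ge0// ltW.
  by move: s1 s2; rewrite expr_div_n; lra.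
move: h; rewrite mulrACA -invfM -k2 -exprVn.
by rewrite -[X in _ <= X]mul1r ler_pM2r// exprn_gt0// invr_gt0.
Qed.

End prekopa_leindler_gauss.

Section standard_gaussian.
Context (R : realType).

Definition sqnorm k (x : 'rV[R]_k) := \sum_i x 0 i ^+ 2.

(** The underlying space is left arbitrary because both properties pass from a
    space to its product with the normal law on the line: an induction on the
    dimension then provides a standard Gaussian vector, without the product of
    a family of measures. *)
Record standard_gaussian d (T : measurableType d) (Q : probability T R) k
    (N : T -> 'rV[R]_k) : Prop := {
  standard_measurable : forall i, measurable_fun setT (fun w => N w 0 i) ;
  standard_cos : forall a b,
    \int[Q]_w cos (dotp a (N w) + b) = expR (- (sqnorm a / 2)) * cos b ;
  standard_tau : forall u v : T -> R, bounded_mfun u -> bounded_mfun v ->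
    (forall w, 0 <= u w) -> (forall w, 0 <= v w) ->
    (forall w w', u w * v w' <= expR (sqnorm (N w - N w') / 4)) ->
    (\int[Q]_w u w) * (\int[Q]_w v w) <= 1 }.

Lemma standard_gaussian0 :
  standard_gaussian (@dirac _ unit tt R) (fun _ => 0 : 'rV[R]_0).
Proof.
have int1 (f : unit -> R) : \int[@dirac _ unit tt R]_w f w = f tt.
  by rewrite /Rintegral integral_dirac// diracT mul1e.
split.
- by case.
- by move=> a b; rewrite int1 /dotp /sqnorm !big_ord0 add0r mul0r oppr0 expR0 mul1r.
- move=> u v _ _ _ _ /(_ tt tt); rewrite !int1 /sqnorm big_ord0 mul0r.
  by rewrite expR0.
Qed.

Definition cons_row k (x : R) (y : 'rV[R]_k) : 'rV[R]_k.+1 :=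
  \row_i (if unlift ord0 i is Some j then y 0 j else x).

Lemma cons_row0 k x (y : 'rV[R]_k) : cons_row x y 0 ord0 = x.
Proof. by rewrite mxE unlift_none. Qed.

Lemma cons_rowS k x (y : 'rV[R]_k) j : cons_row x y 0 (lift ord0 j) = y 0 j.
Proof. by rewrite mxE liftK. Qed.

(** Property tau tensorizes: for fixed first coordinates [x] and [x'], the
    property of the remaining ones bounds the product of the partial integrals
    by [expR ((x - x') ^+ 2 / 4)], which is the hypothesis of the property on
    the line. *)
Lemma standard_gaussianS d (T : measurableType d) (Q : probability T R) k
    (N : T -> 'rV[R]_k) : standard_gaussian Q N ->
  standard_gaussian (normal_prob (0 : R) 1 \x Q)%E
    (fun w : R * T => cons_row w.1 (N w.2)).
Proof.
move=> [mN cosN tauN].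
have mC i : measurable_fun setT (fun w : R * T => cons_row w.1 (N w.2) 0 i).
  have [j ->|->] := unliftP ord0 i.
    under eq_fun do rewrite cons_rowS.
    by apply: (measurableT_comp (mN j)).
  under eq_fun do rewrite cons_row0.
  exact: measurable_fst.
have dotC a x y : dotp a (cons_row x y) =
    a 0 ord0 * x + dotp (\row_j a 0 (lift ord0 j)) y.
  rewrite /dotp big_ord_recl cons_row0; congr (_ + _).
  by apply: eq_bigr => j _; rewrite cons_rowS mxE.
have sqC (x x' : R) y y' : sqnorm (cons_row x y - cons_row x' y') =
    (x - x') ^+ 2 + sqnorm (y - y').
  rewrite /sqnorm big_ord_recl !mxE unlift_none; congr (_ + _).
  by apply: eq_bigr => j _; rewrite !mxE liftK.
split=> //.
- move=> a b.
  have bc : bounded_mfun (fun w : R * T => cos (dotp a (cons_row w.1 (N w.2)) + b)).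
    by apply: bounded_mfun_cos; apply: measurable_funD => //; exact: measurable_dotp.
  rewrite [LHS](fubini_bounded (normal_prob (0 : R) 1) Q bc).2.
  set a' := \row_j a 0 (lift ord0 j).
  transitivity (\int[normal_prob (0 : R) 1]_x
      (expR (- (sqnorm a' / 2)) * cos (a 0 ord0 * x + b))).
    apply: eq_Rintegral => x _; rewrite -cosN; apply: eq_Rintegral => y _.
    by congr cos; rewrite /= dotC -/a'; ring.
  rewrite Rintegral_boundedZ; last first.
    by apply: bounded_mfun_cos; apply: measurable_funD => //; exact: measurable_funM.
  have := @normal_cos_lin R 0 1 (oner_neq0 R) (a 0 ord0) b.
  under eq_Rintegral do rewrite subr0.
  move=> ->; rewrite expr1n mul1r mulrA -expRD; congr (expR _ * _).
  rewrite /sqnorm [in RHS]big_ord_recl.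
  rewrite (_ : \sum_(i < k) a' 0 i ^+ 2 =
               \sum_(i < k) a 0 (lift ord0 i) ^+ 2); last first.
    by apply: eq_bigr => i _; rewrite mxE.
  by field.
move=> u v bu bv u0 v0 uv.
have [bU ->] := fubini_bounded (normal_prob (0 : R) 1) Q bu.
have [bV ->] := fubini_bounded (normal_prob (0 : R) 1) Q bv.
apply: property_tau_line => //.
- by move=> x; exact: Rintegral_ge0.
- by move=> x; exact: Rintegral_ge0.
move=> x x'; set e := expR _.
have e0 : 0 < e by exact: expR_gt0.
rewrite -[leRHS]mul1r -ler_pdivrMr// mulrC mulrA.
have bux := bounded_mfun_section x bu; have bvx := bounded_mfun_section x' bv.
rewrite -(Rintegral_boundedZ Q e^-1 bux).
apply: (tauN (fun w => e^-1 * u (x, w)) (fun w => v (x', w))) => //.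
- exact: (bounded_mfunM (bounded_mfun_cst _) bux).
- by move=> w; rewrite mulr_ge0// invr_ge0 ltW.
- move=> w w'; rewrite -mulrA mulrC ler_pdivrMr// [leRHS]mulrC /e -expRD.
  by rewrite (le_trans (uv (x, w) (x', w')))// ler_expR /= sqC mulrDl lexx.
Qed.

Theorem standard_gaussian_exists k : exists d (T : measurableType d)
  (Q : probability T R) (N : T -> 'rV[R]_k), standard_gaussian Q N.
Proof.
elim: k => [|k [d [T [Q [N sN]]]]].
  by do 4 eexists; exact: standard_gaussian0.
by do 4 eexists; exact: (standard_gaussianS sN).
Qed.

End standard_gaussian.

(** * Covariance matrices *)
Section psd.
Context (R : rcfType).

Definition psd n (K : 'M[R]_n) :=
  K^T = K /\ forall a : 'rV[R]_n, 0 <= (a *m K *m a^T) 0 0.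

(** Induction on the size, splitting off the first coordinate. If its variance
    [k] vanishes then so do its covariances; otherwise the Schur complement is
    again positive semidefinite. *)
Lemma cholesky n (K : 'M[R]_n) : psd K -> exists L : 'M[R]_n, K = L *m L^T.
Proof.
elim: n K => [|n IH] K; first by exists 0; apply/matrixP => -[].
move: K; rewrite -[n.+1]/(1 + n)%N => K [symK psdK].
pose b : 'rV[R]_n := ursubmx (K : 'M[R]_(1 + n)).
pose K' : 'M[R]_n := drsubmx (K : 'M[R]_(1 + n)).
pose k := K 0 0.
have KE : K = block_mx k%:M b b^T K' :> 'M[R]_(1 + n).
  rewrite -[LHS](@submxK _ 1 n 1 n); congr block_mx.
    apply/matrixP => i j; rewrite !ord1 !mxE eqxx mulr1n.
    by congr (K _ _); apply/val_inj.
  by rewrite /b trmx_ursub symK.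
have symK' : K'^T = K' by rewrite /K' trmx_drsub symK.
have tr11 (A : 'M[R]_1) : A^T = A by apply/matrixP => i j; rewrite !ord1 mxE.
have qf (t : R) (a : 'rV[R]_n) :
    0 <= t ^+ 2 * k + 2 * t * (b *m a^T) 0 0 + (a *m K' *m a^T) 0 0.
  have := psdK (row_mx t%:M a : 'rV[R]_(1 + n)); rewrite KE.
  rewrite mul_row_block tr_row_mx mul_row_col !mulmxDl tr_scalar_mx.
  rewrite -!scalar_mxM !mul_scalar_mx.
  have -> : a *m b^T *m t%:M = t *: (b *m a^T).
    by rewrite mul_mx_scalar -[b *m _]tr11 trmx_mul trmxK.
  by rewrite -scalemxAl !mxE eqxx mulr1n => h; apply: le_trans h _; lra.
have k0 : 0 <= k.
  by have := qf 1 0; rewrite trmx0 !mulmx0 !mxE expr1n; lra.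
have [kz|kp] := eqVneq k 0.
  have b0 : b = 0.
    pose s := (b *m b^T) 0 0.
    have h t : 0 <= 2 * t * s + (b *m K' *m b^T) 0 0.
      by have := qf t b; rewrite kz mulr0 add0r.
    (* an affine function of [t] that is bounded below is constant *)
    have sz : s = 0.
      have := h (- s); have := h (-(1 + (b *m K' *m b^T) 0 0) / (2 * s)).
      have [->//|s0] := eqVneq s 0.
      rewrite (_ : 2 * _ * s = - (1 + (b *m K' *m b^T) 0 0)); last by field.
      lra.
    have sE : s = \sum_j b 0 j ^+ 2.
      by rewrite /s mxE; apply: eq_bigr => j _; rewrite [b^T _ _]mxE expr2.
    have /psumr_eq0P b2 : \sum_j b 0 j ^+ 2 = 0 by rewrite -sE.
    apply/rowP => j; rewrite [RHS]mxE; apply/eqP; rewrite -sqrf_eq0; apply/eqP.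
    by apply: b2 => // i _; exact: sqr_ge0.
  have [|L' L'E] := IH K'.
    split=> // a; have := qf 0 a; rewrite expr0n/=; lra.
  exists (block_mx 0 0 0 L' : 'M[R]_(1 + n)).
  rewrite tr_block_mx mulmx_block KE kz b0 !trmx0 !mul0mx !mulmx0 !addr0 add0r -L'E.
  by rewrite raddf0.
have kpos : 0 < k by rewrite lt_neqAle eq_sym kp.
pose r := Num.sqrt k.
have r0 : r != 0 by rewrite gt_eqF// sqrtr_gt0.
have r2 : r * r = k by rewrite -expr2 sqr_sqrtr.
have [|L' L'E] := IH (K' - k^-1 *: (b^T *m b)).
  split.
    by rewrite raddfB/= linearZ/= symK' trmx_mul trmxK.
  move=> a; set s := (b *m a^T) 0 0.
  have -> : (a *m (K' - k^-1 *: (b^T *m b)) *m a^T) 0 0 =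
            (a *m K' *m a^T) 0 0 - k^-1 * s ^+ 2.
    rewrite mulmxBr mulmxBl -scalemxAr -scalemxAl.
    rewrite [LHS]mxE [X in _ + X]mxE [X in - X]mxE; congr (_ - _ * _).
    rewrite !mulmxA -(mulmxA (a *m b^T)) [LHS]mxE big_ord1 expr2; congr (_ * _).
    by rewrite -[RHS]/((b *m a^T) 0 0) -[b *m _]tr11 trmx_mul trmxK.
  (* this first coordinate minimizes the quadratic form *)
  have := qf (- s / k) a; rewrite -/s.
  rewrite (_ : _ ^+ 2 * k + _ = - (k^-1 * s ^+ 2)); last by field.
  by rewrite addrC.
exists (block_mx r%:M 0 (r^-1 *: b^T) L' : 'M[R]_(1 + n)).
rewrite tr_block_mx mulmx_block KE !trmx0 !mul0mx !mulmx0 !addr0 tr_scalar_mx.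
rewrite -scalar_mxM r2 linearZ/= trmxK -L'E.
rewrite mul_scalar_mx mul_mx_scalar !scalerA divff// !scale1r.
rewrite -scalemxAl -scalemxAr scalerA -invfM r2.
by rewrite addrC subrK.
Qed.

Lemma mulmx_tr_eq0 m n (A : 'M[R]_(m, n)) : A *m A^T = 0 -> A = 0.
Proof.
move=> A0; apply/matrixP => i j; rewrite [RHS]mxE.
have /matrixP/(_ i i) := A0; rewrite !mxE => /psumr_eq0P h.
apply/eqP; rewrite -sqrf_eq0 expr2; apply/eqP.
have -> : A i j * A i j = A i j * A^T j i by rewrite mxE.
by apply: h => // k _; rewrite mxE -expr2 sqr_ge0.
Qed.

(** The rows of [C] are the coefficients of the linear regression of all
    coordinates on those in [I], for the covariance matrix [K]. The normal
    equations are solvable even when [K] is singular, because a combination of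
    the coordinates in [I] without variance has no covariance with any
    coordinate. *)
Lemma regression n (K : 'M[R]_n) (I : {set 'I_n}) : psd K ->
  exists C : 'M[R]_n,
  [/\ forall i j, j \notin I -> C i j = 0,
      forall i j, i \in I -> C i j = (i == j)%:R
    & forall i j, j \in I -> (C *m K) i j = K i j].
Proof.
move=> psdK; have [L KE] := cholesky psdK.
pose D : 'M[R]_n := diag_mx (\row_i (i \in I)%:R).
have DT : D^T = D by rewrite tr_diag_mx.
have DE (i j : 'I_n) : D i j = ((i == j) && (i \in I))%:R.
  by rewrite !mxE; case: eqP => // <-; rewrite mulr1n.
have mulD m (A : 'M[R]_(m, n)) i j : (A *m D) i j = A i j * (j \in I)%:R.
  by rewrite mul_mx_diag !mxE.
have Dmul m (A : 'M[R]_(n, m)) i j : (D *m A) i j = (i \in I)%:R * A i j.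
  by rewrite mul_diag_mx !mxE.
have /submxP[G GE] : (K *m D <= D *m K *m D)%MS.
  rewrite submxE; have := mulmx_coker (D *m K *m D).
  move: (cokermx _) => X DX.
  have : (X^T *m D *m L) *m (X^T *m D *m L)^T = 0.
    rewrite !trmx_mul trmxK DT.
    transitivity (X^T *m (D *m (L *m L^T) *m D *m X)); first by rewrite !mulmxA.
    by rewrite -KE DX mulmx0.
  move=> /mulmx_tr_eq0 XL; apply/eqP.
  have : (X^T *m D *m L)^T = 0 by rewrite XL trmx0.
  rewrite !trmx_mul trmxK DT => LX.
  by rewrite KE -!mulmxA LX mulmx0.
exists (D + (1%:M - D) *m (G *m D)).
have nD m (A : 'M[R]_(n, m)) i j : ((1%:M - D) *m A) i j = (i \notin I)%:R * A i j.
  rewrite mulmxBl mul1mx [LHS]mxE [X in _ + X]mxE Dmul.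
  by case: (i \in I); rewrite /= ?mul1r ?mul0r ?subrr ?subr0.
split=> [i j jI|i j iI|i j jI].
- rewrite mxE nD mulD DE (negbTE jI) mulr0 mulr0 addr0.
  by case: eqP => // ->; rewrite (negbTE jI).
- by rewrite mxE nD DE iI andbT /= mul0r addr0.
have -> : ((D + (1%:M - D) *m (G *m D)) *m K) i j =
          ((D + (1%:M - D) *m (G *m D)) *m K *m D) i j.
  by rewrite mulD jI mulr1.
have aux (E : 'M[R]_n) : (D + E *m (G *m D)) *m K *m D =
    D *m (K *m D) + E *m (K *m D).
  rewrite 2!mulmxDl -!mulmxA; congr (_ + _ *m _).
  by rewrite [RHS]GE !mulmxA.
rewrite aux mxE Dmul nD !mulD jI mulr1.
by case: (i \in I); rewrite /= ?mul1r ?mul0r ?add0r ?addr0.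
Qed.

End psd.

(** * Gaussian vectors *)
Section square_integrable.
Context (R : realType) (d : measure_display) (T : measurableType d).
Context (P : probability T R).

Lemma integrable_sqr_Lfun2 (f : T -> R) : measurable_fun setT f ->
  P.-integrable setT (EFin \o (fun w => f w ^+ 2)) -> f \in Lfun P 2%:E.
Proof.
move=> mf /integrableP[_ fy]; rewrite inE; apply/andP; split; rewrite inE//=.
rewrite /finite_norm unlock; apply: poweR_lty; apply: le_lt_trans fy.
apply: ge0_le_integral => //=.
- apply/measurable_EFinP; apply: (measurableT_comp (measurable_powR _)).
  exact: measurableT_comp.
- apply/measurable_EFinP; apply: measurableT_comp => //.
  exact: measurable_funX.
- by move=> w _; rewrite lee_fin normrX powR_mulrn.
Qed.

Lemma Lfun2D (f g : T -> R) :
  f \in Lfun P 2%:E -> g \in Lfun P 2%:E -> (f \+ g)%R \in Lfun P 2%:E.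
Proof. by move=> fL gL; rewrite rpredD ?lee1n. Qed.

Let Pfin : P setT \is a fin_num. Proof. exact: fin_num_measure. Qed.

Lemma gaussian_Lfun2 (U : T -> R) (m s : R) : measurable_fun setT U ->
  (forall B : set R, measurable B -> P (U @^-1` B) = gaussian_law m s B) ->
  [/\ U \in Lfun P 2%:E, ('E_P[U] = m%:E)%E & ('V_P[U] = (s ^+ 2)%:E)%E].
Proof.
move=> mU lawU; have [i2 i1 e1 e2 _] := gaussian_variable_moments mU lawU.
have UmL : (U \- cst m)%R \in Lfun P 2%:E.
  by apply: integrable_sqr_Lfun2 i2; exact: measurable_funB.
have UE : U = ((U \- cst m) \+ cst m)%R by apply/funext => w /=; rewrite subrK.
have UL : U \in Lfun P 2%:E.
  by rewrite UE; apply: Lfun2D => //; exact: Lfun_cst.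
have EU : ('E_P[U] = m%:E)%E.
  rewrite UE expectationD ?expectation_cst; last 2 first.
  - exact: Lfun_subset12.
  - exact: Lfun_cst.
  by rewrite unlock e1 add0e.
split=> //; rewrite /variance unlock EU /= unlock -e2.
by apply: eq_integral => w _; rewrite /= expr2.
Qed.

Lemma Lfun2_sum (I : Type) (r : seq I) (a : I -> R) (X : I -> T -> R) :
  (forall i, X i \in Lfun P 2%:E) ->
  (fun w => \sum_(i <- r) a i * X i w) \in Lfun P 2%:E.
Proof.
move=> XL; elim: r => [|i r IH].
  by under eq_fun do rewrite big_nil; exact: Lfun_cst.
have -> : (fun w => \sum_(j <- i :: r) a j * X j w) =
    ((a i \o* X i) \+ (fun w => \sum_(j <- r) a j * X j w))%R.
  by apply/funext => w /=; rewrite big_cons (mulrC (a i)).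
by apply: Lfun2D => //; apply: Lfun_scale => //; rewrite ler1n.
Qed.

Lemma covariance_suml (I : Type) (r : seq I) (a : I -> R) (X : I -> T -> R) Z :
  (forall i, X i \in Lfun P 2%:E) -> Z \in Lfun P 2%:E ->
  (covariance P (fun w => \sum_(i <- r) a i * X i w)%R Z =
   \sum_(i <- r) (a i)%:E * covariance P (X i) Z)%E.
Proof.
move=> XL ZL; elim: r => [|i r IH].
  rewrite big_nil; under [X in covariance _ X]eq_fun do rewrite big_nil.
  exact: covariance_cst_l.
have -> : (fun w => \sum_(j <- i :: r) a j * X j w) =
    ((a i \o* X i) \+ (fun w => \sum_(j <- r) a j * X j w))%R.
  by apply/funext => w /=; rewrite big_cons (mulrC (a i)).
rewrite covarianceDl//; last 2 first.
- by apply: Lfun_scale => //; rewrite ler1n.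
- exact: Lfun2_sum.
rewrite big_cons IH covarianceZl//; [exact: Lfun_subset12|exact: Lfun_subset12|].
exact: Lfun2_mul_Lfun1.
Qed.

Lemma expectation_suml (I : Type) (r : seq I) (a : I -> R) (X : I -> T -> R) :
  (forall i, X i \in Lfun P 2%:E) ->
  ('E_P[fun w => \sum_(i <- r) a i * X i w]%R =
   \sum_(i <- r) (a i)%:E * 'E_P[X i])%E.
Proof.
move=> XL; elim: r => [|i r IH].
  rewrite big_nil; under [X in expectation _ X]eq_fun do rewrite big_nil.
  exact: expectation_cst.
have -> : (fun w => \sum_(j <- i :: r) a j * X j w) =
    ((a i \o* X i) \+ (fun w => \sum_(j <- r) a j * X j w))%R.
  by apply/funext => w /=; rewrite big_cons (mulrC (a i)).
rewrite expectationD//; last 2 first.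
- by apply: Lfun_subset12 => //; apply: Lfun_scale => //; rewrite ler1n.
- by apply: Lfun_subset12 => //; exact: Lfun2_sum.
by rewrite big_cons IH expectationZl//; exact: Lfun_subset12.
Qed.

End square_integrable.

Section gaussian_vectors.
Context (R : realType) (d : measure_display) (T : measurableType d).
Context (P : probability T R) (n : nat) (X : {RV P >-> rvec R n}) (K : 'M[R]_n).
Hypotheses (gaussX : gaussian_vector X) (covX : covariance_kernel X K).

Let x_ i w : R := (X w : 'rV[R]_n) 0 i.

Lemma measurable_coord_rv i : measurable_fun setT (x_ i).
Proof. by apply: (measurableT_comp (measurable_coord i)). Qed.

Lemma coord_Lfun2 i : x_ i \in Lfun P 2%:E.
Proof.
have [m [s [s0 law]]] := gaussX (delta_mx 0 i).
have [] // := @gaussian_Lfun2 _ _ _ P (x_ i) m s (measurable_coord_rv i).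
move=> B mB; rewrite -law//; congr (P _); apply/funext => w /=; congr (B _).
by have := dotp_delta 1 i (X w); rewrite scale1r mul1r.
Qed.

Definition mean_vector : 'rV[R]_n := \row_i fine 'E_P[x_ i].

Lemma covariance_dotp_coord a j :
  covariance P (fun w => dotp a (X w)) (x_ j) = ((a *m K) 0 j)%:E.
Proof.
rewrite /dotp (covariance_suml _ (X := x_) _ (coord_Lfun2)); last exact: coord_Lfun2.
rewrite mxE -sumEFin; apply: eq_bigr => i _.
by rewrite EFinM; congr (_ * _)%E; exact: covX.
Qed.

Lemma dotp_Lfun2 a : (fun w => dotp a (X w)) \in Lfun P 2%:E.
Proof. exact: (Lfun2_sum _ (X := x_) _ coord_Lfun2). Qed.

Lemma covariance_dotp a b :
  covariance P (fun w => dotp a (X w)) (fun w => dotp b (X w)) =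
  ((a *m K *m b^T) 0 0)%:E.
Proof.
rewrite covarianceC [LHS](covariance_suml _ (X := x_) _ coord_Lfun2) ?dotp_Lfun2//.
rewrite mxE -sumEFin; apply: eq_bigr => i _.
by rewrite covarianceC covariance_dotp_coord -EFinM mulrC [X in _ = (_ * X)%:E]mxE.
Qed.

Lemma variance_dotp a : 'V_P[fun w => dotp a (X w)] = ((a *m K *m a^T) 0 0)%:E.
Proof. exact: covariance_dotp. Qed.

Lemma psd_covariance : psd K.
Proof.
split; first by apply/matrixP => i j; rewrite mxE; apply: EFin_inj;
  rewrite -!covX covarianceC.
by move=> a; rewrite -lee_fin -variance_dotp variance_ge0.
Qed.

(** The characteristic function only depends on the mean and the covariance
    matrix; this is how the law of a Gaussian vector is identified. *)
Lemma gaussian_cos a b : \int[P]_w cos (dotp a (X w) + b) =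
  expR (- ((a *m K *m a^T) 0 0 / 2)) * cos (dotp a mean_vector + b).
Proof.
have [m [s [s0 law]]] := gaussX a.
have mU : measurable_fun setT (fun w => dotp a (X w)).
  by apply: measurable_dotp => i; exact: measurable_coord_rv.
have [_ EU VU] := gaussian_Lfun2 mU law.
have [_ _ _ _ ->] := gaussian_variable_moments mU law.
move: VU; rewrite variance_dotp => -[<-].
suff -> : m = dotp a mean_vector by [].
apply: EFin_inj; rewrite -EU [LHS](expectation_suml _ (X := x_) _ coord_Lfun2).
rewrite -sumEFin; apply: eq_bigr => i _.
rewrite mxE EFinM fineK//; apply: expectation_fin_num.
by apply: Lfun_subset12 (coord_Lfun2 i); exact: fin_num_measure.
Qed.

End gaussian_vectors.

(** * The maximum correlation coefficient bounds linear regression *)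
Lemma mx_norm_entry (R : realType) m n (A : 'M[R]_(m, n)) i j : A i j <= `|A|.
Proof.
rewrite (le_trans (ler_norm _))// /Num.Def.normr/= mx_normrE.
exact: (le_bigmax _ (fun ij : 'I_m * 'I_n => `|A ij.1 ij.2|) (i, j)).
Qed.

Section correlation.
Context (R : realType) (d : measure_display) (T : measurableType d).
Context (P : probability T R).

Let Pfin : P setT \is a fin_num. Proof. exact: fin_num_measure. Qed.

Let cov_fin (Y Z : T -> R) : Y \in Lfun P 2%:E -> Z \in Lfun P 2%:E ->
  covariance P Y Z \is a fin_num.
Proof.
move=> YL ZL; apply: covariance_fin_num.
- exact: Lfun_subset12 YL.
- exact: Lfun_subset12 ZL.
- exact: Lfun2_mul_Lfun1.
Qed.

(** The one-sided bound [covariance_le], applied to [Y] and to its opposite. *)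
Lemma covariance_sqr_le (Y Z : T -> R) : Y \in Lfun P 2%:E -> Z \in Lfun P 2%:E ->
  fine (covariance P Y Z) ^+ 2 <= fine 'V_P[Y] * fine 'V_P[Z].
Proof.
move=> YL ZL.
have V0 W : 0 <= fine 'V_P[W] :> R by apply: fine_ge0; exact: variance_ge0.
have h W : W \in Lfun P 2%:E -> fine (covariance P W Z) <=
    Num.sqrt (fine 'V_P[W] * fine 'V_P[Z]).
  move=> WL; have := covariance_le WL ZL.
  rewrite -(fineK (cov_fin WL ZL)) -(fineK (variance_fin_num WL)).
  by rewrite -(fineK (variance_fin_num ZL)) /= lee_fin sqrtrM.
have hY := h _ YL.
have NYL : (\- Y)%R \in Lfun P 2%:E.
  have -> : (\- Y)%R = (-1 \o* Y)%R by apply/funext => w /=; rewrite mulrN1.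
  by apply: Lfun_scale => //; rewrite ler1n.
have := h _ NYL.
rewrite varianceN// covarianceNl ?fineN; last 3 first.
- exact: Lfun_subset12 YL.
- exact: Lfun_subset12 ZL.
- exact: Lfun2_mul_Lfun1.
move=> hN; rewrite -[leRHS]sqr_sqrtr ?mulr_ge0// -real_normK ?num_real//.
by rewrite ler_sqr ?nnegrE ?sqrtr_ge0// ler_norml hY andbT lerNl.
Qed.

Lemma correlation_le1 (Y Z : T -> R) : Y \in Lfun P 2%:E -> Z \in Lfun P 2%:E ->
  `|fine (covariance P Y Z)| / Num.sqrt (fine 'V_P[Y] * fine 'V_P[Z]) <= 1.
Proof.
move=> YL ZL; have h := covariance_sqr_le YL ZL.
have [->|s0] := eqVneq (Num.sqrt (fine 'V_P[Y] * fine 'V_P[Z])) 0.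
  by rewrite invr0 mulr0 ler01.
rewrite ler_pdivrMr ?mul1r; last by rewrite lt_neqAle eq_sym s0 sqrtr_ge0.
by rewrite -sqrtr_sqr ler_wsqrtr.
Qed.

Context (n : nat) (X : {RV P >-> rvec R n}) (I1 I2 : {set 'I_n}).

Let corr_set := [set r | exists (f : rvec R #|I1| -> R) (g : rvec R #|I2| -> R),
    let Y1 := fun w => f (restr I1 (X w)) in
    let Y2 := fun w => g (restr I2 (X w)) in
    [/\ measurable_fun setT f, measurable_fun setT g,
        Y1 \in Lfun P 2%:E, Y2 \in Lfun P 2%:E
      & r = `|fine (covariance P Y1 Y2)|
            / Num.sqrt (fine 'V_P[Y1] * fine 'V_P[Y2])]].

Let corr_set_ub : has_ubound corr_set.
Proof. by exists 1 => _ [f [g [mf mg Y1L Y2L ->]]]; exact: correlation_le1. Qed.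

(** The square form of the definition, which also covers variables without
    variance; the supremum is genuine because correlations are at most 1. *)
Lemma max_correlation_ge (f : rvec R #|I1| -> R) (g : rvec R #|I2| -> R)
    (Y1 Y2 : T -> R) :
  Y1 = (fun w => f (restr I1 (X w))) -> Y2 = (fun w => g (restr I2 (X w))) ->
  measurable_fun setT f -> measurable_fun setT g ->
  Y1 \in Lfun P 2%:E -> Y2 \in Lfun P 2%:E ->
  fine (covariance P Y1 Y2) ^+ 2 <=
  max_correlation X I1 I2 ^+ 2 * (fine 'V_P[Y1] * fine 'V_P[Y2]).
Proof.
move=> Y1E Y2E mf mg Y1L Y2L.
set V := fine 'V_P[Y1] * fine 'V_P[Y2].
have V0 : 0 <= V by rewrite mulr_ge0// fine_ge0// variance_ge0.
have cs := covariance_sqr_le Y1L Y2L; rewrite -/V in cs.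
have [Vz|Vn] := eqVneq V 0; first by rewrite Vz in cs; rewrite Vz mulr0.
have sV : 0 < Num.sqrt V by rewrite sqrtr_gt0 lt_neqAle eq_sym Vn.
have : `|fine (covariance P Y1 Y2)| / Num.sqrt V <= max_correlation X I1 I2.
  by apply: (ub_le_sup corr_set_ub); exists f, g; split; rewrite -?Y1E -?Y2E.
rewrite ler_pdivrMr// => h.
rewrite -real_normK ?num_real// -[V in leRHS]sqr_sqrtr// -exprMn.
by rewrite ler_sqr// nnegrE (le_trans _ h).
Qed.

Variable K : 'M[R]_n.
Hypotheses (gaussX : gaussian_vector X) (covX : covariance_kernel X K).
Variable C : 'M[R]_n.
Hypothesis C0 : forall i j, j \notin I1 -> C i j = 0.
Hypothesis CK : forall i j, j \in I1 -> (C *m K) i j = K i j.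

Lemma regression_residual : (K - C *m K) *m C^T = 0.
Proof.
apply/matrixP => i j; rewrite [RHS]mxE mxE big1// => k _; rewrite [C^T _ _]mxE.
have [kI|kI] := boolP (k \in I1); last by rewrite C0 ?mulr0.
  have -> : (K - C *m K) i k = 0 by rewrite [LHS]mxE [(- (C *m K)) i k]mxE CK ?subrr.
  by rewrite mul0r.
Qed.

Lemma regression_variance : K *m C^T = C *m K *m C^T.
Proof.
by apply/eqP; rewrite -subr_eq0 -mulmxBl regression_residual.
Qed.

(** The regression of [X_i] on the coordinates in [I1] is a function of these
    coordinates, and its covariance with [X_i] is its own variance [v]: hence
    [v ^+ 2 <= rho ^+ 2 * (v * K i i)]. *)
Lemma regression_correlation i : i \in I2 ->
  (C *m K *m C^T) i i <= max_correlation X I1 I2 ^+ 2 * `|K|.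
Proof.
move=> iI2; have [symK psdK] := psd_covariance gaussX covX.
set v := (C *m K *m C^T) i i.
have vE : (row i C *m K *m (row i C)^T) 0 0 = v.
  rewrite -row_mul tr_row /v [LHS]mxE [RHS]mxE; apply: eq_bigr => j _.
  by rewrite [row i _ _ _]mxE [col _ _ _ _]mxE.
have cE : (C *m K) i i = v.
  by rewrite /v -regression_variance -[in RHS]symK -trmx_mul [RHS]mxE.
have v0 : 0 <= v by rewrite -vE; exact: psdK.
have K0 : 0 <= K i i.
  have := psdK (delta_mx 0 i); rewrite -rowE trmx_delta.
  by rewrite -colE !mxE.
pose f (y : rvec R #|I1|) : R := \sum_k C i (enum_val k) * (y : 'rV[R]_#|I1|) 0 k.
pose k2 := enum_rank_in iI2 i.
pose g (y : rvec R #|I2|) : R := (y : 'rV[R]_#|I2|) 0 k2.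
pose Y1 w := dotp (row i C) (X w); pose Y2 w : R := (X w : 'rV[R]_n) 0 i.
have Y1E : Y1 = (fun w => f (restr I1 (X w))).
  apply/funext => w; rewrite /Y1 /f /dotp.
  rewrite (bigID (mem I1)) /= [X in _ + X]big1 ?addr0; last first.
    by move=> j jI; rewrite mxE C0// mul0r.
  rewrite big_enum_val/=; apply: eq_bigr => k _.
  by rewrite mxE [in RHS]/restr mxE.
have Y2E : Y2 = (fun w => g (restr I2 (X w))).
  by apply/funext => w; rewrite /Y2 /g /restr mxE enum_rankK_in.
have mf : measurable_fun setT f.
  by apply: measurable_sum => k; apply: measurable_funM => //; exact: measurable_coord.
have := max_correlation_ge Y1E Y2E mf (measurable_coord k2)
  (dotp_Lfun2 gaussX (row i C)) (coord_Lfun2 gaussX i).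
rewrite (covariance_dotp_coord gaussX covX) (variance_dotp gaussX covX) vE.
rewrite /variance (covX i i) /= -row_mul mxE cE => h.
have [->|vn] := eqVneq v 0; first by rewrite mulr_ge0 ?sqr_ge0.
have vp : 0 < v by rewrite lt_neqAle eq_sym vn.
apply: (@le_trans _ _ (max_correlation X I1 I2 ^+ 2 * K i i)); last first.
  by rewrite ler_wpM2l ?sqr_ge0// mx_norm_entry.
by rewrite -(ler_pM2l vp) -expr2 mulrCA.
Qed.

End correlation.

(** * Decoupling *)
Section level_sets.
Context (R : realType) (d : measure_display) (T : measurableType d).
Context (P : probability T R).

Lemma bounded_mfun_level (f : T -> R) q : bounded_mfun f ->
  bounded_mfun (\1_[set w | q <= f w] : T -> R).
Proof.
move=> [mf _]; apply: bounded_mfun_indic.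
have := measurable_fun_ler (measurable_cst q) mf.
by move=> /(_ measurableT [set true] I); rewrite setTI.
Qed.

(** If at every level [q] either [f] is rarely above [q] or [g] is rarely below
    [q], then [f] is essentially below and [g] essentially above the common
    threshold [qs], the supremum of the levels that [g] mostly exceeds. Hence
    [a * f] integrates to at most about [qs] times the mean of [a], which the
    product of the means of [a] and [g] reaches up to [delta]. *)
Lemma level_decoupling (a f g : T -> R) (delta : R) :
  bounded_mfun a -> bounded_mfun f -> bounded_mfun g ->
  (forall w, 0 <= a w <= 1) -> (forall w, 0 <= f w <= 1) -> (forall w, 0 <= g w <= 1) ->
  0 <= delta <= 1 ->
  (forall q, \int[P]_w \1_[set w | q <= f w] w <= delta \/
             1 - \int[P]_w \1_[set w | q <= g w] w <= delta) ->
  \int[P]_w (a w * f w) - (\int[P]_w a w) * (\int[P]_w g w) <= delta.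
Proof.
move=> ba bf bg a01 f01 g01 /andP[d0 d1] dich.
set pa := \int[P]_w a w; set eg := \int[P]_w g w.
have pa0 : 0 <= pa by apply: Rintegral_ge0 => w _; have /andP[] := a01 w.
have pa1 : pa <= 1.
  rewrite -(Rintegral_prob_cst P 1); apply: le_Rintegral_bounded => //.
    exact: bounded_mfun_cst.
  by move=> w; have /andP[] := a01 w.
pose S := [set q : R | 0 <= q <= 1 /\ 1 - \int[P]_w \1_[set w | q <= g w] w <= delta].
have S0 : S 0.
  split; first by rewrite lexx ler01.
  rewrite (_ : \int[P]_w _ = 1) ?subrr// -[RHS](Rintegral_prob_cst P 1).
  by apply: eq_Rintegral => w _; rewrite indicE mem_set//=; have /andP[] := g01 w.
have ubS : has_ubound S by exists 1 => q [/andP[]].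
pose qs := sup S.
have qs0 : 0 <= qs by exact: ub_le_sup.
have qs1 : qs <= 1 by apply: ge_sup; [exists 0|move=> q [/andP[]]].
(* the supremum need not be attained: approach it from both sides *)
suff H eta : 0 < eta -> \int[P]_w (a w * f w) - pa * eg <= delta + 2 * eta.
  apply/ler_addgt0Pr => e e0; rewrite (le_trans (H (e / 2) _))//; last lra.
  by rewrite divr_gt0.
move=> eta0.
have upper : \int[P]_w (a w * f w) <= pa * (qs + eta) + (1 - qs) * delta.
  have lev : \int[P]_w \1_[set w | qs + eta <= f w] w <= delta.
    have [//|Sq] := dich (qs + eta).
    have [q1|q1] := leP (qs + eta) 1.
      have : qs + eta <= qs.
        by apply: ub_le_sup => //; split=> //; rewrite q1 andbT; lra.
      lra.
    rewrite (_ : \int[P]_w _ = 0)// -[RHS](Rintegral_prob_cst P 0).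
    apply: eq_Rintegral => w _; rewrite indicE memNset//= => h.
    by have /andP[_] := f01 w; lra.
  apply: (@le_trans _ _ (\int[P]_w ((qs + eta) * a w +
      (1 - qs) * \1_[set w | qs + eta <= f w] w))).
    apply: le_Rintegral_bounded; first exact: bounded_mfunM.
      apply: bounded_mfunD; first exact: (bounded_mfunM (bounded_mfun_cst _) ba).
      exact: (bounded_mfunM (bounded_mfun_cst _) (bounded_mfun_level _ bf)).
    move=> w; have /andP[a0 a1] := a01 w; have /andP[f0 f1] := f01 w.
    rewrite indicE; case: (leP (qs + eta) (f w)) => h.
      by rewrite mem_set//= mulr1; nra.
    rewrite memNset/= ?mulr0 ?addr0; first by nra.
    by apply/negP; rewrite -ltNge.
  rewrite Rintegral_boundedD ?Rintegral_boundedZ//; last 3 first.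
  - exact: bounded_mfun_level.
  - exact: (bounded_mfunM (bounded_mfun_cst _) ba).
  - exact: (bounded_mfunM (bounded_mfun_cst _) (bounded_mfun_level _ bf)).
  by rewrite -/pa mulrC lerD2l ler_wpM2l// subr_ge0.
have lower : (qs - eta) * (1 - delta) <= eg.
  have [q [/andP[q0 q1] Sq] qq] : exists2 q, S q & qs - eta < q.
    by apply: sup_gt; [exists 0|rewrite ltrBlDr ltrDl].
  apply: (@le_trans _ _ (q * \int[P]_w \1_[set w | q <= g w] w)).
    have h : 1 - delta <= \int[P]_w \1_[set w | q <= g w] w by lra.
    apply: (@le_trans _ _ (q * (1 - delta))); last by rewrite ler_wpM2l.
    by rewrite ler_wpM2r ?subr_ge0// ltW.
  rewrite -Rintegral_boundedZ; last exact: bounded_mfun_level.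
  apply: le_Rintegral_bounded => //.
    exact: (bounded_mfunM (bounded_mfun_cst _) (bounded_mfun_level _ bg)).
  move=> w; have /andP[g0 g1] := g01 w.
  rewrite indicE; case: (leP q (g w)) => h; first by rewrite mem_set//= mulr1.
  by rewrite memNset/= ?mulr0//; apply/negP; rewrite -ltNge.
have : pa * ((qs - eta) * (1 - delta)) <= pa * eg by rewrite ler_wpM2l.
have : 0 <= pa * eta * delta by rewrite !mulr_ge0// ltW.
have : 0 <= (1 - pa) * (qs * delta) by rewrite !mulr_ge0// subr_ge0.
have : 0 <= (1 - pa) * eta by rewrite mulr_ge0 ?subr_ge0// ltW.
move: upper; nra.
Qed.

End level_sets.

Section separated_sets.
Context (R : realType) (d : measure_display) (T : measurableType d).
Context (Q : probability T R) (k : nat) (N : T -> 'rV[R]_k).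
Hypothesis sN : standard_gaussian Q N.

(** Property tau for the indicators of two sets at squared distance at least
    [D], one of them multiplied by [expR (D / 4)]. *)
Lemma gaussian_separated (A B : set T) (D : R) : measurable A -> measurable B ->
  (forall w w', A w -> B w' -> D <= sqnorm (N w - N w')) ->
  (\int[Q]_w \1_A w) * (\int[Q]_w \1_B w) <= expR (- (D / 4)).
Proof.
move=> mA mB sep.
have bA := bounded_mfun_indic R mA; have bB := bounded_mfun_indic R mB.
have := standard_tau sN (bounded_mfunM (bounded_mfun_cst (expR (D / 4))) bA) bB.
have i01 (E : set T) w : 0 <= (\1_E w : R) by rewrite indicE.
rewrite Rintegral_boundedZ// => h.
rewrite expRN -[leRHS]mulr1 ler_pdivlMl ?expR_gt0// mulrA; apply: h => //.
move=> w w'; rewrite !indicE.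
have [wA|_] := boolP (w \in A); last by rewrite mulr0 mul0r expR_ge0.
have [wB|_] := boolP (w' \in B); last by rewrite mulr0 expR_ge0.
rewrite !mulr1 ler_expR ler_pM2r ?invr_gt0//.
by apply: sep; exact: set_mem.
Qed.

(** One of the two factors of a product is at most its geometric mean: this
    halves the exponent, and is where the constant 8 comes from. *)
Lemma gaussian_separated_small (A B : set T) (D : R) :
  measurable A -> measurable B ->
  (forall w w', A w -> B w' -> D <= sqnorm (N w - N w')) ->
  \int[Q]_w \1_A w <= expR (- (D / 8)) \/ \int[Q]_w \1_B w <= expR (- (D / 8)).
Proof.
move=> mA mB sep; have h := gaussian_separated mA mB sep.
have [|ltA] := leP (\int[Q]_w \1_A w) (expR (- (D / 8))); first by left.
right; rewrite leNgt; apply/negP => ltB.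
move: h; apply/negP; rewrite -ltNge.
have -> : expR (- (D / 4)) = expR (- (D / 8)) * expR (- (D / 8)).
  by rewrite -expRD; congr expR; lra.
by rewrite ltr_pM ?expR_ge0.
Qed.

End separated_sets.

Lemma dotpE (R : realType) n (a x : 'rV[R]_n) : dotp a x = (a *m x^T) 0 0.
Proof. by rewrite mxE; apply: eq_bigr => i _; rewrite mxE. Qed.

Section dotp_matrix.
Context (R : realType) (n : nat).

Lemma dotp_mulmx m (a : 'rV[R]_n) (B : 'M[R]_(n, m)) x :
  dotp a (x *m B^T) = dotp (a *m B) x.
Proof. by rewrite !dotpE trmx_mul trmxK mulmxA. Qed.

Lemma dotpDr (a x y : 'rV[R]_n) : dotp a (x + y) = dotp a x + dotp a y.
Proof. by rewrite !dotpE raddfD/= mulmxDr mxE. Qed.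

Lemma sqnormE (x : 'rV[R]_n) : sqnorm x = (x *m x^T) 0 0.
Proof. by rewrite mxE; apply: eq_bigr => i _; rewrite mxE expr2. Qed.

(** The discriminant of the nonnegative quadratic polynomial
    [t |-> sqnorm (a + t *: x)]. *)
Lemma cauchy_schwarz (a x : 'rV[R]_n) : dotp a x ^+ 2 <= sqnorm a * sqnorm x.
Proof.
have q t : 0 <= sqnorm a + 2 * t * dotp a x + t ^+ 2 * sqnorm x.
  have -> : sqnorm a + 2 * t * dotp a x + t ^+ 2 * sqnorm x =
            \sum_i (a 0 i + t * x 0 i) ^+ 2.
    rewrite /sqnorm /dotp !mulr_sumr -!big_split/=; apply: eq_bigr => i _; ring.
  by apply: sumr_ge0 => i _; exact: sqr_ge0.
have x0 : 0 <= sqnorm x by apply: sumr_ge0 => i _; exact: sqr_ge0.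
have a0 : 0 <= sqnorm a by apply: sumr_ge0 => i _; exact: sqr_ge0.
have [xz|xn] := eqVneq (sqnorm x) 0.
  rewrite xz mulr0; suff -> : dotp a x = 0 by rewrite expr0n.
  apply: big1 => i _.
  have /psumr_eq0P x2 := xz.
  have : x 0 i ^+ 2 = 0 by apply: x2 => // j _; exact: sqr_ge0.
  by move/eqP; rewrite sqrf_eq0 => /eqP ->; rewrite mulr0.
have xp : 0 < sqnorm x by rewrite lt_neqAle eq_sym xn.
(* the minimum of the polynomial *)
have := q (- dotp a x / sqnorm x).
rewrite (_ : _ + _ = sqnorm a - dotp a x ^+ 2 / sqnorm x); last by field.
by rewrite subr_ge0 ler_pdivrMr.
Qed.

End dotp_matrix.

Section monotone.
Context (R : realType) (n : nat) (I : {set 'I_n}).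

(** The form in which monotonicity and support are used together: only the
    order of the coordinates in [I] matters. *)
Definition increasing_on (A : set 'rV[R]_n) :=
  forall x y : 'rV[R]_n, (forall i, i \in I -> x 0 i <= y 0 i) -> A x -> A y.

Lemma increasing_supported (A : set (rvec R n)) :
  increasing_event A -> supported_on I A -> increasing_on A.
Proof.
move=> incA suppA x y xy Ax.
pose v := \row_i (if i \in I then y 0 i - x 0 i else 0).
pose z := \row_i (if i \in I then 0 else y 0 i - x 0 i).
have -> : y = x + v + z.
  by apply/rowP => i; rewrite !mxE; case: ifP => _; ring.
have zI i : i \in I -> z 0 i = 0 by move=> iI; rewrite mxE iI.
apply: (suppA z zI (x + v)).1.
by apply: incA => // i; rewrite mxE; case: ifPn => // iI; rewrite subr_ge0 xy.
Qed.

End monotone.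

Lemma measurable_mulmx_coord (R : realType) n m d (T : measurableType d)
    (U : T -> 'rV[R]_n) (B : 'M[R]_(n, m)) i :
  (forall i, measurable_fun setT (fun w => U w 0 i)) ->
  measurable_fun setT (fun w => (U w *m B) 0 i).
Proof.
move=> mU; under eq_fun do rewrite mxE.
by apply: measurable_sum => j; apply: measurable_funM.
Qed.

Section decoupling.
Context (R : realType) (d : measure_display) (T : measurableType d).
Context (P : probability T R) (n : nat) (X : {RV P >-> rvec R n}) (K : 'M[R]_n).
Hypotheses (gaussX : gaussian_vector X) (covX : covariance_kernel X K).
Context (I : {set 'I_n}) (C : 'M[R]_n).
Hypothesis C0 : forall i j, j \notin I -> C i j = 0.
Hypothesis CK : forall i j, j \in I -> (C *m K) i j = K i j.

Let Xr w : 'rV[R]_n := X w.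

Let mX i : measurable_fun setT (fun w => Xr w 0 i).
Proof. exact: measurable_coord_rv. Qed.

Definition regressed (x : 'rV[R]_n) := x *m C^T.
Definition residual (x : 'rV[R]_n) := x *m (1%:M - C)^T.

(** The regression on the coordinates in [I] comes from a first sample, and the
    residual, which is uncorrelated with it, from an independent one. Where the
    regression fixes the coordinates in [I], these are those of the first
    sample. *)
Definition recoupled (w : T * T) : 'rV[R]_n := regressed (Xr w.1) + residual (Xr w.2).

Lemma measurable_recoupled i : measurable_fun setT (fun w => recoupled w 0 i).
Proof.
rewrite /recoupled; under eq_fun do rewrite mxE.
by apply: measurable_funD; apply: measurable_mulmx_coord => j;
  apply: (measurableT_comp (mX j)).
Qed.

(** The regression and the residual are uncorrelated, so resampling the residual
    changes neither the mean nor the covariance, hence not the law. *)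
Lemma recoupled_law (A : set (rvec R n)) : measurable A ->
  P (Xr @^-1` A) = (P \x P)%E (recoupled @^-1` A).
Proof.
apply: cramer_wold => //; first exact: measurable_recoupled.
move=> a b.
have bc : bounded_mfun (fun w => cos (dotp a (recoupled w) + b)).
  by apply: bounded_mfun_cos; apply: measurable_funD => //; apply: measurable_dotp;
    exact: measurable_recoupled.
rewrite [RHS](fubini_bounded P P bc).2.
set a1 := a *m C; set a2 := a *m (1%:M - C).
transitivity (\int[P]_w (expR (- ((a2 *m K *m a2^T) 0 0 / 2)) *
   cos (dotp a1 (X w) + (dotp a2 (mean_vector X) + b)))); last first.
  apply: eq_Rintegral => w _.
  have := gaussian_cos gaussX covX a2 (dotp a1 (X w) + b).
  rewrite [X in cos X](_ : _ =
    dotp a1 (X w) + (dotp a2 (mean_vector X) + b)); last by ring.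
  move=> <-; apply: eq_Rintegral => w' _; congr cos.
  by rewrite /recoupled /= dotpDr !dotp_mulmx; ring.
rewrite Rintegral_boundedZ; last first.
  by apply: bounded_mfun_cos; apply: measurable_funD => //; apply: measurable_dotp.
rewrite !(gaussian_cos gaussX covX) mulrA -expRD; congr (expR _ * cos _).
  have aE : a = a1 + a2 by rewrite -mulmxDr addrC subrK mulmx1.
  have cross : (a2 *m K *m a1^T) = 0.
    rewrite /a1 /a2 trmx_mul mulmxA -(mulmxA a) -(mulmxA a) mulmxBl mul1mx.
    by rewrite (regression_residual C0 CK) mulmx0 mul0mx.
  have [symK _] := psd_covariance gaussX covX.
  have swap (u v : 'rV[R]_n) : u *m K *m v^T = 0 -> v *m K *m u^T = 0.
    by move=> /(congr1 trmx); rewrite trmx0 !trmx_mul trmxK symK mulmxA.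
  have cross' := swap _ _ cross.
  rewrite {1 2}aE raddfD/= !mulmxDl !mulmxDr cross cross' addr0 add0r mxE.
  by lra.
have aE : a = a1 + a2 by rewrite -mulmxDr addrC subrK mulmx1.
by rewrite {1}aE dotpD; ring.
Qed.

End decoupling.

Lemma measurable_affine (R : realType) n d (T : measurableType d) m (U : T -> 'rV[R]_m)
    (B : 'M[R]_(m, n)) (c : 'rV[R]_n) :
  (forall i, measurable_fun setT (fun w => U w 0 i)) ->
  measurable_fun setT (fun w => (U w *m B + c) : rvec R n).
Proof.
move=> mU; apply: measurable_rvec => i; under eq_fun do rewrite mxE.
by apply: measurable_funD => //; exact: measurable_mulmx_coord.
Qed.

Section gaussian_level_sets.
Context (R : realType) (d : measure_display) (T : measurableType d).
Context (P : probability T R) (n : nat) (X : {RV P >-> rvec R n}) (K : 'M[R]_n).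
Hypotheses (gaussX : gaussian_vector X) (covX : covariance_kernel X K).

(** Both vectors have the same mean and the same covariance [L *m L^T]. *)
Lemma gaussian_standard_law d' (T' : measurableType d') (Q : probability T' R)
    (N : T' -> 'rV[R]_n) (L : 'M[R]_n) : standard_gaussian Q N -> K = L *m L^T ->
  forall B : set (rvec R n), measurable B ->
    P (X @^-1` B) = Q ((fun w => N w *m L^T + mean_vector X) @^-1` B).
Proof.
move=> sN KE B mB.
apply: (@cramer_wold _ _ _ _ _ P Q n (fun w => X w : 'rV[R]_n)) => //.
- by move=> i; exact: measurable_coord_rv.
- move=> i; under eq_fun do rewrite mxE.
  apply: measurable_funD => //; apply: measurable_mulmx_coord.
  exact: (standard_measurable sN).
move=> a b; rewrite (gaussian_cos gaussX covX).
transitivity (\int[Q]_w cos (dotp (a *m L) (N w) + (dotp a (mean_vector X) + b))).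
  rewrite (standard_cos sN) sqnormE; congr (expR (- (_ 0 0 / 2)) * _).
  by rewrite KE trmx_mul !mulmxA.
by apply: eq_Rintegral => w _; congr cos; rewrite dotpDr dotp_mulmx; ring.
Qed.

Context (I : {set 'I_n}) (C : 'M[R]_n) (s2 eps : R).
Hypotheses (eps_gt0 : 0 < eps) (s2_ge0 : 0 <= s2).
Hypothesis varC : forall i, i \in I -> (C *m K *m C^T) i i <= s2.

(** Write the vector as an affine image of a standard Gaussian vector [N]. If [w]
    is sent into [B], and [w'] outside of [B] even after adding [eps], then by
    monotonicity some coordinate in [I] drops by more than [eps] between them;
    as that coordinate is a linear form in [N] of squared norm at most [s2],
    [N w] and [N w'] are at squared distance at least [eps ^+ 2 / s2]. If
    [s2 = 0] no such pair exists, and one of the two sets is empty. *)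
Lemma increasing_dichotomy (B : set (rvec R n)) : measurable B -> increasing_on I B ->
  let delta := if s2 == 0 then 0 else expR (- (eps ^+ 2 / (8 * s2))) in
  \int[P]_w \1_[set w | B (regressed C (X w))] w <= delta \/
  1 - \int[P]_w \1_[set w | B (regressed C (X w) + const_mx eps)] w <= delta.
Proof.
move=> mB incB delta.
have [L KE] := cholesky (psd_covariance gaussX covX).
have [d' [T' [Q [N sN]]]] := standard_gaussian_exists R n.
pose Mn w := regressed C (N w *m L^T + mean_vector X).
have mN := standard_measurable sN.
have mR c : measurable ([set x | B (regressed C x + c)] : set (rvec R n)).
  have := @measurable_affine R n _ (rvec R n) n (fun x => x : 'rV[R]_n) C^T c
    (@measurable_coord R n) measurableT B mB.
  by rewrite setTI.
have mX S : measurable S -> measurable (X @^-1` S).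
  by move=> mS; rewrite -[_ @^-1` _]setTI; exact: (measurable_funP X).
have mQ c : measurable [set w | B (Mn w + c)].
  have := @measurable_affine R n _ T' n N L^T (mean_vector X) mN measurableT _ (mR c).
  by rewrite setTI.
have law c : \int[P]_w \1_[set w | B (regressed C (X w) + c)] w =
             \int[Q]_w \1_[set w | B (Mn w + c)] w.
  apply: EFin_inj; rewrite !Rintegral_indic//; last exact: (mX _ (mR c)).
  exact: (gaussian_standard_law sN KE (mR c)).
have := law 0; under [X in \1_X]eq_set do rewrite addr0.
under [X in _ = \int[Q]_w \1_X w]eq_set do rewrite addr0.
move=> ->; rewrite law.
have mS0 : measurable [set w | B (Mn w)].
  by have := mQ 0; under eq_set do rewrite addr0.
have mS1 : measurable (~` [set w | B (Mn w + const_mx eps)]) by exact: measurableC.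
have -> : 1 - \int[Q]_w \1_[set w | B (Mn w + const_mx eps)] w =
    \int[Q]_w \1_(~` [set w | B (Mn w + const_mx eps)]) w.
  rewrite -[X in X - _](Rintegral_prob_cst Q) -Rintegral_boundedB; last 2 first.
  - exact: bounded_mfun_cst.
  - exact: bounded_mfun_indic.
  apply: eq_Rintegral => w _; rewrite !indicE in_setC.
  by case: (_ \in _); rewrite ?subrr ?subr0.
have sep w w' : B (Mn w) -> ~ B (Mn w' + const_mx eps) ->
    eps ^+ 2 < s2 * sqnorm (N w - N w').
  move=> Bw nBw'.
  have [i iI lt] : exists2 i, i \in I & Mn w' 0 i + eps < Mn w 0 i.
    apply: contrapT => h; apply: nBw'; apply: incB Bw => i iI.
    rewrite [leRHS]mxE [X in _ + X]mxE leNgt; apply/negP => lt.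
    by apply: h; exists i.
  have E : Mn w 0 i - Mn w' 0 i = dotp (row i (C *m L)) (N w - N w').
    have -> : Mn w 0 i - Mn w' 0 i = (Mn w - Mn w') 0 i by rewrite !mxE.
    rewrite /Mn /regressed -mulmxBl opprD addrACA subrr addr0.
    rewrite -mulmxBl -mulmxA -trmx_mul.
    rewrite [LHS]mxE; apply: eq_bigr => j _; rewrite [(C *m L)^T _ _]mxE.
    by rewrite [row _ _ _ _]mxE mulrC.
  have V : sqnorm (row i (C *m L)) = (C *m K *m C^T) i i.
    rewrite KE -!mulmxA mulmxA -trmx_mul mxE.
    by apply: eq_bigr => j _; rewrite [row _ _ _ _]mxE [X in _ * X]mxE expr2.
  have e2 : eps ^+ 2 < (Mn w 0 i - Mn w' 0 i) ^+ 2.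
    have lt' : eps < Mn w 0 i - Mn w' 0 i by rewrite ltrBrDl.
    by rewrite ltr_pXn2r// nnegrE ltW// (lt_trans eps_gt0 lt').
  rewrite (lt_le_trans e2)// E (le_trans (cauchy_schwarz _ _))//.
  rewrite V ler_wpM2r ?varC//.
  by apply: sumr_ge0 => j _; exact: sqr_ge0.
have zero (S : set T') : measurable S -> (forall w, ~ S w) -> \int[Q]_w \1_S w <= 0.
  move=> mS S0; rewrite -[leRHS](Rintegral_prob_cst Q); apply: le_Rintegral_bounded.
  - exact: bounded_mfun_indic.
  - exact: bounded_mfun_cst.
  - by move=> w; rewrite indicE memNset.
rewrite /delta; have [s20|s20] := eqVneq s2 0.
  have [[w0 Bw0]|nB] := pselect (exists w, B (Mn w)).
    right; apply: zero => // w' nBw'.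
    by have := sep _ _ Bw0 nBw'; rewrite s20 mul0r ltNge sqr_ge0.
  by left; apply: zero => // w Bw; apply: nB; exists w.
have s2p : 0 < s2 by rewrite lt_neqAle eq_sym s20.
rewrite (_ : eps ^+ 2 / (8 * s2) = (eps ^+ 2 / s2) / 8); last by field.
apply: (gaussian_separated_small sN) => // w w' Bw nBw'.
by rewrite ler_pdivrMr// mulrC ltW// sep.
Qed.

End gaussian_level_sets.

(* On matrices, `|K| is the library's max norm. *)
Theorem theorem1p10 (d : measure_display) (T : measurableType d)
    (R : realType) (P : probability T R) (n : nat)
    (X : {RV P >-> rvec R n}) (K : 'M[R]_n)
    (gaussX : gaussian_vector X) (covX : covariance_kernel X K)
    (I1 I2 : {set 'I_n}) (A1 A2 : set (rvec R n))
    (mA1 : measurable A1) (mA2 : measurable A2)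
    (incrA1 : increasing_event A1) (incrA2 : increasing_event A2)
    (suppA1 : supported_on I1 A1) (suppA2 : supported_on I2 A2)
    (eps : R) (eps_gt0 : 0 < eps) :
  let rho := max_correlation X I1 I2 in
  (P [set w | (A1 `&` A2) (X w)]
     - P [set w | A1 (X w)]
       * P [set w | A2 ((X w : 'rV[R]_n) + const_mx eps)%R]
   <= (if rho == 0 then 0
       else expR (- (eps ^+ 2 / (8 * `|K| * rho ^+ 2))))%R%:E)%E.
Proof.
cbv zeta; set rho := max_correlation X I1 I2.
have [C [C0 C1 CK]] := regression I1 (psd_covariance gaussX covX).
pose Xr w : 'rV[R]_n := X w.
have mX i : measurable_fun setT (fun w => Xr w 0 i) by exact: measurable_coord_rv.
have mXset S : measurable S -> measurable (X @^-1` S).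
  by move=> mS; rewrite -[_ @^-1` _]setTI; exact: (measurable_funP X).
have mshift : measurable ([set x | A2 (x + const_mx eps)] : set (rvec R n)).
  have := @measurable_affine R n _ (rvec R n) n (fun x => x : 'rV[R]_n) 1%:M
    (const_mx eps) (@measurable_coord R n) measurableT A2 mA2.
  by rewrite setTI; congr measurable; apply/seteqP; split => x; rewrite /= mulmx1.
pose rec := recoupled X C.
have mrec : measurable_fun setT (rec : T * T -> rvec R n).
  by apply: measurable_rvec => i; exact: measurable_recoupled.
have mrecset (S : set (rvec R n)) : measurable S -> measurable (rec @^-1` S).
  by move=> mS; rewrite -[_ @^-1` _]setTI; exact: mrec.
(* the conditional probability of [A2] when the regression on [I1] equals [x] *)
pose u (x : rvec R n) : R :=
  \int[P]_w \1_A2 (((x : 'rV[R]_n) + residual C (X w)) : rvec R n).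
have bG : bounded_mfun (fun z : rvec R n * T =>
    \1_A2 (((z.1 : 'rV[R]_n) + residual C (X z.2)) : rvec R n) : R).
  have mz : measurable_fun setT
      (fun z : rvec R n * T => (((z.1 : 'rV[R]_n) + residual C (X z.2)) : rvec R n)).
    apply: measurable_rvec => i; under eq_fun do rewrite mxE.
    apply: measurable_funD; first by apply: (measurableT_comp (measurable_coord i)).
    by apply: measurable_mulmx_coord => j; apply: (measurableT_comp (mX j)).
  have [m1 [D hD]] := bounded_mfun_indic R mA2.
  by split; [exact: measurableT_comp m1 mz|exists D => z; exact: hD].
(* only the measurability of a section is needed, so any law will do for [x] *)
have bu : bounded_mfun u by have [] := fubini_bounded (@dirac _ (rvec R n) 0 R) P bG.
have bG1 x : bounded_mfun (fun w =>
    \1_A2 (((x : 'rV[R]_n) + residual C (X w)) : rvec R n) : R).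
  exact: (bounded_mfun_section (x : rvec R n) bG).
have u01 x : 0 <= u x <= 1.
  have i01 y : 0 <= (\1_A2 y : R) <= 1.
    by rewrite indicE; case: (_ \in _); rewrite ?lexx ?ler01.
  apply/andP; split.
    by apply: Rintegral_ge0 => w _; have /andP[] := i01 (x + residual C (X w)).
  rewrite -(Rintegral_prob_cst P 1); apply: le_Rintegral_bounded;
    [exact: bG1|exact: bounded_mfun_cst|move=> w].
  by have /andP[] := i01 (x + residual C (X w)).
have incr2 := increasing_supported incrA2 suppA2.
have u_mono (x y : 'rV[R]_n) : (forall i, i \in I2 -> x 0 i <= y 0 i) -> u x <= u y.
  move=> xy; apply: le_Rintegral_bounded; [exact: bG1|exact: bG1|move=> w].
  rewrite !indicE.
  have [xA|] := boolP (_ \in A2); last by case: (_ \in A2).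
  rewrite mem_set//; apply: incr2 (set_mem xA) => i iI.
  by rewrite !mxE lerD2r xy.
pose a w : R := \1_A1 (X w).
pose f w := u (regressed C (X w)); pose g w := u (regressed C (X w) + const_mx eps).
have bcomp c : bounded_mfun (fun w => u (regressed C (X w) + c)).
  have [mu_ [D hD]] := bu; split; last by exists D => w; exact: hD.
  apply: (measurableT_comp mu_).
  exact: (measurable_affine (U := Xr) C^T c).
have ba : bounded_mfun a.
  have [m1 [D hD]] := bounded_mfun_indic R mA1; split; last by exists D => w; exact: hD.
  exact: measurableT_comp m1 (measurable_funP X).
have bf : bounded_mfun f by have := bcomp 0; rewrite /f; under eq_fun do rewrite addr0.
have bg : bounded_mfun g := bcomp _.
have PA1 : P [set w | A1 (X w)] = (\int[P]_w a w)%:E.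
  by rewrite -(Rintegral_indic P (mXset _ mA1)).
have PA12 : P [set w | (A1 `&` A2) (X w)] = (\int[P]_w (a w * f w))%:E.
  have mA : measurable (A1 `&` A2) by exact: measurableI.
  rewrite [LHS](recoupled_law gaussX covX C0 CK mA).
  rewrite -(Rintegral_indic _ (mrecset _ mA)).
  rewrite (fubini_bounded P P (bounded_mfun_indic R (mrecset _ mA))).2; congr EFin.
  apply: eq_Rintegral => w _; rewrite -Rintegral_boundedZ; last exact: bG1.
  apply: eq_Rintegral => w' _.
  (* The regression fixes the coordinates in [I1], where the residual vanishes. *)
  have recA1 : A1 (rec (w, w')) <-> A1 (X w).
    have vI i : i \in I1 -> (rec (w, w') - Xr w) 0 i = 0.
      move=> iI; rewrite /rec /recoupled /regressed /residual /=.
      rewrite linearB/= trmx1 mulmxBr mulmx1.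
      have CE x : (x *m C^T) 0 i = x 0 i.
        rewrite mxE (bigD1 i)//= [C^T _ _]mxE C1// eqxx mulr1 big1 ?addr0// => j ji.
        by rewrite [C^T _ _]mxE C1// eq_sym (negbTE ji) mulr0.
      rewrite [LHS]mxE [X in X + _]mxE [(- Xr w) 0 i]mxE CE.
      rewrite [(Xr w' - _) 0 i]mxE [(- (Xr w' *m _)) 0 i]mxE CE subrr addr0.
      by rewrite subrr.
    by have := suppA1 _ vI (Xr w); rewrite addrC subrK => h; split => /h.
  rewrite /a !indicE -natrM mulnb; congr (nat_of_bool _)%:R.
  apply/idP/andP.
    by rewrite inE => -[h1 h2]; split; rewrite inE//; exact/recA1.
  by rewrite !inE => -[h1 h2]; split=> //; exact/recA1.
have PA2 : P [set w | A2 ((X w : 'rV[R]_n) + const_mx eps)] = (\int[P]_w g w)%:E.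
  rewrite [LHS](recoupled_law gaussX covX C0 CK mshift).
  rewrite -(Rintegral_indic _ (mrecset _ mshift)).
  rewrite (fubini_bounded P P (bounded_mfun_indic R (mrecset _ mshift))).2; congr EFin.
  apply: eq_Rintegral => w _; apply: eq_Rintegral => w' _.
  rewrite !indicE; congr (nat_of_bool _)%:R.
  by apply/idP/idP; rewrite !inE /= addrAC.
pose s2 := rho ^+ 2 * `|K|.
have varC i : i \in I2 -> (C *m K *m C^T) i i <= s2.
  exact: regression_correlation gaussX covX C C0 CK i.
pose delta := if s2 == 0 then 0 else expR (- (eps ^+ 2 / (8 * s2))).
have s2_ge0 : 0 <= s2 by rewrite mulr_ge0// sqr_ge0.
have d01 : 0 <= delta <= 1.
  rewrite /delta; case: ifP => _; first by rewrite lexx ler01.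
  rewrite expR_ge0/= -[leRHS]expR0 ler_expR oppr_le0 divr_ge0 ?sqr_ge0//.
  by rewrite mulr_ge0.
have main : \int[P]_w (a w * f w) - (\int[P]_w a w) * (\int[P]_w g w) <= delta.
  apply: level_decoupling => //.
  - by move=> w; rewrite /a indicE; case: (_ \in _); rewrite ?lexx ?ler01.
  - by move=> w; exact: u01.
  - by move=> w; exact: u01.
  move=> q; pose B : set (rvec R n) := [set x | q <= u x].
  have mB : measurable B.
    have := measurable_fun_ler (measurable_cst q) bu.1.
    by move=> /(_ measurableT [set true] I); rewrite setTI.
  have incB : increasing_on I2 B.
    by move=> x y xy; rewrite /B /= => /le_trans; apply; exact: u_mono.
  exact: (increasing_dichotomy gaussX covX eps_gt0 s2_ge0 varC mB incB).
rewrite PA1 PA12 PA2 -EFinM -EFinB lee_fin (le_trans main)//.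
rewrite /delta /s2; have [->|rho0] := eqVneq rho 0.
  by rewrite expr0n/= mul0r eqxx.
(* If [K = 0], the exponent is a division by zero, of value [0]. *)
case: ifP => [_|_]; first exact: expR_ge0.
by rewrite -mulrA (mulrC `|K|).
Qed.
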